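(* Let $\mathcal{A}$ and $\mathcal{B}$ be $AW^*$-algebras, let $\mathcal{I}\subseteq\mathcal{A}$ and $\mathcal{J}\subseteq\mathcal{B}$ be operator intervals, and let $\Phi:\mathcal{I}\to\mathcal{J}$ be an order isomorphism. Then there exists a unique pair of order isomorphisms $\Phi_1:p_{\mathcal{A}}(1)\mathcal{I}\to p_{\mathcal{B}}(1)\mathcal{J}$ and $\Phi_{-1}:p_{\mathcal{A}}(1)^\perp\mathcal{I}\to p_{\mathcal{B}}(1)^\perp\mathcal{J}$ such that $$\Phi(a)=\Phi_1\big(p_{\mathcal{A}}(1)a\big)+\Phi_{-1}\big(p_{\mathcal{A}}(1)^\perp a\big)\qquad\text{for all } a\in\mathcal{I}.$$
   Context: All $C^*$-algebras are unital. For a $C^*$-algebra $\mathcal{A}$, $\mathcal{A}^{sa}$ is the self-adjoint part with order $a\le b\iff b-a$ positive; $a<b$ means $b-a$ is positive and invertible. An $AW^*$-algebra is a $C^*$-algebra $\mathcal{A}$ such that for every nonempty $\mathcal{F}\subseteq\mathcal{A}$ there is a projection $p$ with $\{a\in\mathcal{A}:ba=0\ \forall b\in\mathcal{F}\}=p\mathcal{A}$. An operator interval in $\mathcal{A}$ is either $\mathcal{A}^{sa}$, or one of $\{c\in\mathcal{A}^{sa}:c\ge a\}$, $\{c:c\le a\}$, $\{c:a<c\}$, $\{c:c<a\}$ for some $a\in\mathcal{A}^{sa}$, or one of $\{c:a\le c\le b\}$, $\{c:a\le c<b\}$, $\{c:a<c\le b\}$, $\{c:a<c<b\}$ for some $a,b\in\mathcal{A}^{sa}$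 with $a<b$ (all with $c\in\mathcal{A}^{sa}$), with the induced order. For an $AW^*$-algebra $\mathcal{A}$, $p_{\mathcal{A}}(1)$ denotes the unique central projection such that $p_{\mathcal{A}}(1)\mathcal{A}$ is commutative (possibly $0$) and $p_{\mathcal{A}}(1)^\perp\mathcal{A}$ has no nonzero commutative direct summand (i.e. no nonzero central projection $z\le p_{\mathcal{A}}(1)^\perp$ with $z\mathcal{A}$ commutative); $p^\perp=1-p$. For a set $\mathcal{F}$ and projection $p$, $p\mathcal{F}=\{pa:a\in\mathcal{F}\}$, with the induced order. An order isomorphism is a bijection preserving order in both directions. *)

(* Defs.v *)
From HB Require Import structures.
From mathcomp Require Import all_boot all_order all_algebra.
From mathcomp Require Import boolp classical_sets.
From mathcomp Require Import complex.
Set Implicit Arguments. Unset Strict Implicit. Unset Printing Implicit Defensive.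
Import Order.TTheory GRing.Theory Num.Theory.
Local Open Scope ring_scope.
Local Open Scope classical_set_scope.

(** Complex scalars: C = R[i] for R a real closed field (in the theorem R is a
    realType, i.e. the real numbers).  The norm of a C*-algebra is taken with
    values in C; the axiom [0 <= nrm x] forces it to be real and nonnegative. *)

Definition is_cstar (R : rcfType) (A : unitAlgType R[i])
    (st : A -> A) (nrm : A -> R[i]) : Prop :=
  [/\ forall x, 0 <= nrm x,
      forall x, nrm x = 0 -> x = 0,
      forall x y, nrm (x + y) <= nrm x + nrm y &
      forall (k : R[i]) x, nrm (k *: x) = `|k| * nrm x] /\
  (forall u : nat -> A,
     (forall e : R[i], 0 < e -> exists N, forall m n,
         (N <= m)%N -> (N <= n)%N -> nrm (u m - u n) < e) ->
     exists l : A, forall e : R[i], 0 < e -> exists N, forall n,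
         (N <= n)%N -> nrm (u n - l) < e) /\
  (forall x y, nrm (x * y) <= nrm x * nrm y) /\
  [/\ forall x, st (st x) = x,
      forall x y, st (x + y) = st x + st y,
      forall (k : R[i]) x, st (k *: x) = k^* *: st x &
      forall x y, st (x * y) = st y * st x] /\
  (forall x, nrm (st x * x) = nrm x ^+ 2).

Record cstarAlg (R : rcfType) := CStarAlg {
  cs_alg :> unitAlgType R[i];
  cstar : cs_alg -> cs_alg;
  cnorm : cs_alg -> R[i];
  cs_axioms : is_cstar cstar cnorm
}.

Section CStarDefs.
Variables (R : rcfType) (A : cstarAlg R).

Definition selfadj (a : A) : Prop := cstar a = a.

Definition spectrum (a : A) : set R[i] :=
  [set l | ~ (a - l%:A \is a GRing.unit)].

Definition positive (a : A) : Prop :=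
  selfadj a /\ (forall l, spectrum a l -> 0 <= l).

Definition ople (a b : A) : Prop := positive (b - a).
Definition oplt (a b : A) : Prop := positive (b - a) /\ (b - a \is a GRing.unit).

Definition projection (p : A) : Prop := p * p = p /\ cstar p = p.

Definition central (p : A) : Prop := forall x : A, p * x = x * p.

Definition commutative_corner (p : A) : Prop :=
  forall x y : A, (p * x) * (p * y) = (p * y) * (p * x).

Definition AWstar : Prop :=
  forall F : set A, F !=set0 ->
    exists p, projection p /\
      [set a | forall b, F b -> b * a = 0] = [set p * x | x in [set: A]].

(** p = p_A(1): the central projection such that p A is commutative and
    p^perp A has no nonzero commutative direct summand *)
Definition is_pA1 (p : A) : Prop :=
  [/\ projection p, central p, commutative_corner p &
      forall z, projection z -> central z -> ople z (1 - p) ->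
        commutative_corner z -> z = 0].

Inductive opint :=
  | OI_all
  | OI_ge of A | OI_le of A | OI_gt of A | OI_lt of A
  | OI_cc of A & A | OI_co of A & A | OI_oc of A & A | OI_oo of A & A.

Definition opint_valid (I : opint) : Prop :=
  match I with
  | OI_all => True
  | OI_ge a | OI_le a | OI_gt a | OI_lt a => selfadj a
  | OI_cc a b | OI_co a b | OI_oc a b | OI_oo a b =>
      [/\ selfadj a, selfadj b & oplt a b]
  end.

Definition opint_set (I : opint) : set A :=
  match I with
  | OI_all => [set c | selfadj c]
  | OI_ge a => [set c | selfadj c /\ ople a c]
  | OI_le a => [set c | selfadj c /\ ople c a]
  | OI_gt a => [set c | selfadj c /\ oplt a c]
  | OI_lt a => [set c | selfadj c /\ oplt c a]
  | OI_cc a b => [set c | [/\ selfadj c, ople a c & ople c b]]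
  | OI_co a b => [set c | [/\ selfadj c, ople a c & oplt c b]]
  | OI_oc a b => [set c | [/\ selfadj c, oplt a c & ople c b]]
  | OI_oo a b => [set c | [/\ selfadj c, oplt a c & oplt c b]]
  end.

Definition lmulset (p : A) (F : set A) : set A := [set p * a | a in F].

End CStarDefs.

(** order isomorphism X -> Y between subsets carrying the induced operator
    order, represented by a function on the ambient algebras (only its values
    on X matter) *)
Definition order_iso (R : rcfType) (A B : cstarAlg R)
    (X : set A) (Y : set B) (f : A -> B) : Prop :=
  [/\ forall x, X x -> Y (f x),
      forall x y, X x -> X y -> f x = f y -> x = y,
      forall y, Y y -> exists2 x, X x & f x = y &
      forall x y, X x -> X y -> (ople x y <-> ople (f x) (f y))].

(* Main.v *)
(* Two elements b, c of an operator interval with room left above them have a supremum in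
   it iff they are centrally comparable: some central projection f satisfies f b <= f c and (1-f) c <= (1-f) b.
   Indeed, if s is the supremum, u = s - b, v = s - c and m is small, then perturbing s by
   umv + vm^*u minus second order terms again gives an upper bound, which forces uAv = 0;
   the annihilator of uA is then generated by a central projection.

   For a <= b in the interval, consider the condition that sup(c, d) exists whenever
   a <= c <= b and a <= d, and inf(c, d) exists whenever a <= c <= b and d <= b.
   It is order-theoretic, and it is equivalent to (1-p)a = (1-p)b with p = p_A(1).  For
   the nontrivial direction let h, k >= x = b - a (up to scaling) be the room left in
   the interval above a and below b; any y in [0, x] is centrally comparable with every
   multiple of h, so bisection with central projections gives ymh = hmy for all m,
   and likewise for k, hence for the invertible g = h + k.  So yg^-1 is central for every
   y in [0, x], which makes xg^-1 annihilate all commutators, i.e. (1-p)x = 0.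

   Hence Phi preserves the relation (1-p)a = (1-p)b, and therefore also the complementary
   relation pa = pb, and it factors accordingly. *)
Require Import Defs.
From HB Require Import structures.
From mathcomp Require Import all_boot all_order all_algebra.
From mathcomp Require Import boolp classical_sets reals.
From mathcomp Require Import complex.
From mathcomp Require Import ring lra.
From Stdlib Require RelationClasses Ncring Ncring_tac.
Set Implicit Arguments. Unset Strict Implicit. Unset Printing Implicit Defensive.
Import Order.TTheory GRing.Theory Num.Theory.
Local Open Scope ring_scope.
Local Open Scope classical_set_scope.
Local Open Scope complex_scope.

(** * Normalisation of identities in noncommutative rings *)

#[global] Instance nc_ring_ops (A : pzRingType) :
  @Ncring.Ring_ops A 0 1 +%R *%R (fun x y => x - y) -%R eq := {}.
#[global] Instance nc_ring (A : pzRingType) : Ncring.Ring (Ro := nc_ring_ops A).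
Proof.
split.
- exact: RelationClasses.eq_equivalence.
- by move=> x x' -> y y' ->.
- by move=> x x' -> y y' ->.
- by move=> x x' -> y y' ->.
- by move=> x x' ->.
- exact: add0r.
- exact: addrC.
- exact: addrA.
- exact: mul1r.
- exact: mulr1.
- exact: mulrA.
- exact: mulrDl.
- by move=> x y z; exact: mulrDr.
- by [].
- exact: subrr.
Qed.
Ltac ncr := intros; Ncring_tac.non_commutative_ring.

(** * Norm and involution *)

Section Basics.
Variables (R : realType) (A : cstarAlg R).
Implicit Types a b c x y z : A.

(** The values of [cnorm] are nonnegative reals inside R[i]. Taking the real part loses nothing and
    moves estimates to a totally ordered field. *)
Definition nm a : R := complex.Re (cnorm a).

Lemma cnormE a : cnorm a = (nm a)%:C.
Proof.
have [[h0 _ _ _] _] := cs_axioms A.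
by rewrite {1}[cnorm a]complexE (ger0_Im (h0 a)) mulr0 addr0.
Qed.

Lemma nm_ge0 a : 0 <= nm a.
Proof. by have [[h0 _ _ _] _] := cs_axioms A; have := h0 a; rewrite cnormE lecR. Qed.

Lemma nm_eq0 a : nm a = 0 -> a = 0.
Proof. by have [[_ h _ _] _] := cs_axioms A; move=> e; apply: h; rewrite cnormE e. Qed.

Lemma nmD a b : nm (a + b) <= nm a + nm b.
Proof.
have [[_ _ h _] _] := cs_axioms A; have := h a b.
by rewrite !cnormE -rmorphD lecR.
Qed.

Lemma nmZ (k : R[i]) a : nm (k *: a) = complex.Re `|k| * nm a.
Proof.
have [[_ _ _ h] _] := cs_axioms A; have := h k a.
by rewrite !cnormE !normc_def -rmorphM /= => /complexI.
Qed.

Lemma nmZr (k : R) a : nm (k%:C *: a) = `|k| * nm a.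
Proof. by rewrite nmZ normc_def /= expr0n addr0 sqrtr_sqr. Qed.

Lemma nmZi a : nm ('i%R *: a) = nm a.
Proof. by rewrite nmZ -(complexiE R) normc_def /= expr0n add0r expr1n sqrtr1 mul1r. Qed.

Lemma nm0 : nm 0 = 0.
Proof. by rewrite -(scale0r (0 : A)) nmZr normr0 mul0r. Qed.

Lemma nmN a : nm (- a) = nm a.
Proof. by rewrite -scaleN1r (_ : -1 = (-1)%:C) ?nmZr ?normrN1 ?mul1r // rmorphN. Qed.

Lemma nmB a b : nm (a - b) <= nm a + nm b.
Proof. by rewrite -(nmN b) nmD. Qed.

Lemma nm_distC a b : nm (a - b) = nm (b - a).
Proof. by rewrite -nmN opprB. Qed.

Lemma nmM a b : nm (a * b) <= nm a * nm b.
Proof.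
have [_ [_ [h _]]] := cs_axioms A; have := h a b.
by rewrite !cnormE -rmorphM lecR.
Qed.

Lemma nmstM a : nm (cstar a * a) = nm a ^+ 2.
Proof.
have [_ [_ [_ [_ h]]]] := cs_axioms A; have := h a.
by rewrite !cnormE -rmorphXn => /complexI.
Qed.

Lemma nm_complete (u : nat -> A) :
  (forall e : R, 0 < e -> exists N, forall m n, (N <= m)%N -> (N <= n)%N ->
     nm (u m - u n) < e) ->
  exists l, forall e : R, 0 < e -> exists N, forall n, (N <= n)%N -> nm (u n - l) < e.
Proof.
have [_ [h _]] := cs_axioms A; move=> hu.
have [|l hl] := h u.
  case=> er ei; rewrite ltcE /= => /andP[/eqP -> /hu[N hN]].
  by exists N => m n hm hn; rewrite cnormE ltcR hN.
exists l => e e0; have [|N hN] := hl e%:C; first by rewrite ltcR.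
by exists N => n /hN; rewrite cnormE ltcR.
Qed.

Lemma stK a : cstar (cstar a) = a.
Proof. by have [_ [_ [_ [[] ]]]] := cs_axioms A. Qed.
Lemma stD a b : cstar (a + b) = cstar a + cstar b.
Proof. by have [_ [_ [_ [[] ]]]] := cs_axioms A. Qed.
Lemma stZ (k : R[i]) a : cstar (k *: a) = k^*%R *: cstar a.
Proof. by have [_ [_ [_ [[] ]]]] := cs_axioms A. Qed.
Lemma stM a b : cstar (a * b) = cstar b * cstar a.
Proof. by have [_ [_ [_ [[] ]]]] := cs_axioms A. Qed.
Lemma stZr (k : R) a : cstar (k%:C *: a) = k%:C *: cstar a.
Proof. by rewrite stZ conj_Creal // complex_real. Qed.
Lemma stZi a : cstar ('i%R *: a) = - ('i%R *: cstar a).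
Proof. by rewrite stZ conjCi scaleNr. Qed.
Lemma st0 : cstar (0 : A) = 0.
Proof. by have := stZ 0 0; rewrite conjC0 !scale0r. Qed.
Lemma stN a : cstar (- a) = - cstar a.
Proof. by apply: (addrI (cstar a)); rewrite -stD !subrr st0. Qed.
Lemma stB a b : cstar (a - b) = cstar a - cstar b.
Proof. by rewrite stD stN. Qed.
Lemma st1 : cstar (1 : A) = 1.
Proof. by rewrite -[LHS]mul1r -{1}(stK 1) -stM mul1r stK. Qed.

(** The C*-identity at 1 makes this norm equal to its own square, and it is nonzero because the ring
    is nontrivial. *)
Lemma nm1 : nm 1 = 1.
Proof.
have := nmstM 1; rewrite st1 mul1r expr2 => /eqP.
rewrite -{1}[nm 1]mulr1 -subr_eq0 -mulrBr mulf_eq0 => /orP[/eqP/nm_eq0/eqP|].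
  by rewrite oner_eq0.
by rewrite subr_eq0 => /eqP.
Qed.

Lemma nm_alg (k : R) : nm k%:C%:A = `|k|.
Proof. by rewrite nmZr nm1 mulr1. Qed.

Lemma nm_gt0 a : a != 0 -> 0 < nm a.
Proof. by move=> a0; rewrite lt_def nm_ge0 andbT; apply: contra_neq a0 => /nm_eq0. Qed.

Lemma nmst a : nm (cstar a) = nm a.
Proof.
suff le b : nm b <= nm (cstar b).
  by apply/eqP; rewrite eq_le le -{2}(stK a) le.
have [->|b0] := eqVneq b 0; first by rewrite st0.
by rewrite -(ler_pM2r (nm_gt0 b0)) -expr2 -nmstM nmM.
Qed.

Lemma stV a : cstar a^-1 = (cstar a)^-1.
Proof.
have stU b : b \is a GRing.unit -> cstar b \is a GRing.unit.
  by move=> ub; apply/unitrP; exists (cstar b^-1); rewrite -!stM divrr ?mulVr // st1.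
have [ua|nua] := boolP (a \is a GRing.unit); last first.
  by rewrite !invr_out //; apply: contra nua => /stU; rewrite stK.
by apply: (mulrI (stU _ ua)); rewrite -stM mulVr ?st1 ?divrr ?stU.
Qed.

Lemma saM a b : selfadj a -> selfadj b -> a * b = b * a -> selfadj (a * b).
Proof. by rewrite /selfadj stM => -> -> ->. Qed.
Lemma saD a b : selfadj a -> selfadj b -> selfadj (a + b).
Proof. by rewrite /selfadj stD => -> ->. Qed.
Lemma saN a : selfadj a -> selfadj (- a).
Proof. by rewrite /selfadj stN => ->. Qed.
Lemma saB a b : selfadj a -> selfadj b -> selfadj (a - b).
Proof. by rewrite /selfadj stB => -> ->. Qed.
Lemma saZ (k : R) a : selfadj a -> selfadj (k%:C *: a).
Proof. by rewrite /selfadj stZr => ->. Qed.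
Lemma sa1 : selfadj (1 : A). Proof. exact: st1. Qed.
Lemma sa0 : selfadj (0 : A). Proof. exact: st0. Qed.
Lemma saV a : selfadj a -> selfadj a^-1.
Proof. by rewrite /selfadj stV => ->. Qed.

Lemma nm_sa2 a : selfadj a -> nm (a * a) = nm a ^+ 2.
Proof. by rewrite -nmstM => ->. Qed.

End Basics.
Arguments nm {R A}.

(** * Completeness, Neumann series and square roots *)

Lemma addKBl (V : zmodType) (x y z : V) : (x + y) - (x + z) = y - z.
Proof. by rewrite opprD addrACA subrr add0r. Qed.

Section Complete.
Variables (R : realType) (A : cstarAlg R).
Implicit Types a b c x y z : A.

Definition cvgs (u : nat -> A) l :=
  forall e : R, 0 < e -> exists N, forall n, (N <= n)%N -> nm (u n - l) < e.

(** Two consecutive indices at once, so that a recursion for [u] passes to the limit. *)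
Lemma cvgs_shift u l : cvgs u l -> forall e : R, 0 < e ->
  exists n, nm (u n - l) < e /\ nm (u n.+1 - l) < e.
Proof. by move=> h e /h[N hN]; exists N; split; apply: hN. Qed.

Lemma nm_small (C : R) a : (forall e, 0 < e -> nm a <= C * e) -> a = 0.
Proof.
move=> h; apply: nm_eq0; apply/eqP; rewrite eq_le nm_ge0 andbT leNgt.
apply/negP => a0.
have C0 : 0 < C by have := h 1 ltr01; rewrite mulr1; apply: lt_le_trans.
have := h (nm a / (C *+ 2)) (divr_gt0 a0 _).
rewrite pmulrn_lgt0 // => /(_ C0).
have -> : C * (nm a / (C *+ 2)) = nm a / 2 by field; rewrite gt_eqF.
lra.
Qed.

(** Majorant method: increments of [u] are dominated by those of the nondecreasing bounded scalar
    sequence [z], which ends up within e of its supremum. *)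
Lemma dominated_cvgs (u : nat -> A) (z : nat -> R) (M : R) :
  (forall n m, (n <= m)%N -> nm (u m - u n) <= z m - z n) ->
  (forall n, z n <= M) -> exists l, cvgs u l.
Proof.
move=> hz zM; apply: nm_complete => e e0.
have hs : has_sup (range z).
  by split; [exists (z 0%N), 0%N | exists M => _ [n _ <-]].
have [_ [N _ <-] hN] := sup_adherent e0 hs.
have hle n : z n <= sup (range z) by apply: ub_le_sup; [case: hs | exists n].
have mono n m : (n <= m)%N -> z n <= z m.
  by move=> /hz h; rewrite -subr_ge0; apply: le_trans h; rewrite nm_ge0.
exists N => m n Nm Nn; wlog nm_ : m n Nm Nn / (n <= m)%N.
  by case/orP: (leq_total n m) => h; [|rewrite nm_distC]; auto.
have := hz _ _ nm_; have := hle m; have := mono _ _ Nn; lra.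
Qed.

Lemma cvgs_comm u l x : cvgs u l -> (forall n, u n * x = x * u n) -> l * x = x * l.
Proof.
move=> hl hx; apply/eqP; rewrite -subr_eq0; apply/eqP.
apply: (@nm_small (nm x *+ 2)) => e e0.
have [n [hn _]] := cvgs_shift hl e0.
have -> : l * x - x * l = x * (u n - l) - (u n - l) * x.
  by rewrite mulrBr mulrBl hx; ncr.
apply: le_trans (nmB _ _) _; rewrite [leRHS]mulrnAl mulr2n.
apply: lerD; apply: le_trans (nmM _ _) _.
  by rewrite ler_wpM2l ?nm_ge0 // ltW.
by rewrite mulrC ler_wpM2l ?nm_ge0 // ltW.
Qed.

Lemma neumann x : nm x < 1 -> 1 - x \is a GRing.unit.
Proof.
move=> x1; have x0 := nm_ge0 x.
(* Partial sums of the geometric series in Horner form; [z] is the same recursion with [nm x] in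
   place of [x]. *)
pose u := fix u n := if n is n'.+1 then 1 + x * u n' else 0 : A.
pose z := fix z n := if n is n'.+1 then 1 + nm x * z n' else 0 : R.
have hu n : nm (u n) <= z n.
  elim: n => [|n ih] /=; first by rewrite nm0.
  apply: le_trans (nmD _ _) _; rewrite nm1 lerD2l.
  by apply: le_trans (nmM _ _) _; rewrite ler_wpM2l.
have [n m|n|l hl] := @dominated_cvgs u z (1 - nm x)^-1.
- elim: n m => [|n ih] [|m] // nm_; first by rewrite /= !subr0 nm0.
    by rewrite !subr0 hu.
  rewrite /= !addKBl -!mulrBr.
  apply: le_trans (nmM _ _) _; rewrite ler_wpM2l //; exact: ih.
- have h : 0 < 1 - nm x by lra.
  rewrite -[leRHS]mul1r ler_pdivlMr //.
  elim: n => [|n ih] /=; first by rewrite mul0r ler01.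
  have : nm x * (z n * (1 - nm x)) <= nm x * 1 by rewrite ler_wpM2l.
  nra.
have h1 : (1 - x) * l = 1.
  apply/eqP; rewrite -subr_eq0; apply/eqP; apply: (@nm_small (1 + nm x)) => e e0.
  have [n [hn hn1]] := cvgs_shift hl e0.
  have -> : (1 - x) * l - 1 = x * (u n - l) - (u n.+1 - l) by rewrite /=; ncr.
  apply: le_trans (nmB _ _) _; rewrite [leRHS]mulrDl mul1r addrC.
  apply: lerD; first exact: ltW.
  by apply: le_trans (nmM _ _) _; rewrite ler_wpM2l // ltW.
apply/unitrP; exists l; split => //.
rewrite -[RHS]h1; symmetry; rewrite mulrBl mulrBr mul1r mulr1; congr (_ - _).
by symmetry; apply: (cvgs_comm hl); elim=> [|n ih] /=; rewrite ?mul0r ?mulr0 // mulrDl mulrDr -mulrA ih mul1r mulr1.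
Qed.

Lemma unit_near a b : a \is a GRing.unit -> nm (b - a) * nm a^-1 < 1 ->
  b \is a GRing.unit.
Proof.
move=> ua h; have -> : b = (1 - (a - b) * a^-1) * a.
  by rewrite mulrBl mul1r -mulrA mulVr // mulr1; ncr.
rewrite unitrMl //; apply: neumann.
by apply: le_lt_trans (nmM _ _) _; rewrite nm_distC.
Qed.

(** The root is r = 1 - l, where l is the limit of the iteration l = (y + l^2)/2, so that (1 - l)^2
    = 1 - 2l + l^2 = 1 - y. The majorant is the same iteration at y = 1, which stays in [0, 1].
    Commutation passes from the iterates, which are polynomials in y, to l. *)
Lemma sqrt_iter y : selfadj y -> nm y <= 1 ->
  exists r, [/\ selfadj r, r * r = 1 - y, nm (1 - r) <= 1 &
    forall w, y * w = w * y -> r * w = w * r].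
Proof.
move=> ysa y1.
pose h : R[i] := (2^-1 : R)%:C.
pose u := fix u n := if n is n'.+1 then h *: (y + u n' * u n') else 0 : A.
pose z := fix z n := if n is n'.+1 then 2^-1 * (1 + z n' * z n') else 0 : R.
have nmh x : nm (h *: x) = 2^-1 * nm x by rewrite nmZr ger0_norm // invr_ge0.
have z0 n : 0 <= z n.
  by elim: n => [|n ih] //=; nra.
have z1 n : z n <= 1.
  by elim: n => [|n ih] //=; have := z0 n; nra.
have hu n : nm (u n) <= z n.
  elim: n => [|n ih] /=; first by rewrite nm0.
  rewrite nmh ler_wpM2l ?invr_ge0 //; apply: le_trans (nmD _ _) _.
  apply: lerD => //; apply: le_trans (nmM _ _) _.
  by rewrite ler_pM ?nm_ge0.
have sqB a b : a * a - b * b = a * (a - b) + (a - b) * b by ncr.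
have [n m|n|l hl] := @dominated_cvgs u z 1; last 2 first.
- exact: z1.
- have lcomm w : y * w = w * y -> l * w = w * l.
    move=> yw; apply: (cvgs_comm hl); elim=> [|n ih] /=; first by rewrite mul0r mulr0.
    by rewrite -scalerAl -scalerAr mulrDl mulrDr yw mulrA -ih -!mulrA ih.
  have lsa : cstar l = l.
    apply/eqP; rewrite -subr_eq0; apply/eqP; apply: (@nm_small 2) => e e0.
    have [n [hn _]] := cvgs_shift hl e0.
    have un : cstar (u n) = u n.
      by elim: {hn} n => [|n ih] /=; rewrite ?st0 // stZr stD stM ih ysa.
    have -> : cstar l - l = (u n - l) - cstar (u n - l) by rewrite stB un; ncr.
    apply: le_trans (nmB _ _) _; rewrite nmst; lra.
  have l1 : nm l <= 1.
    rewrite leNgt; apply/negP => l1.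
    have [|n [hn _]] := @cvgs_shift _ _ hl (nm l - 1); first by rewrite subr_gt0.
    have := nmB (u n) (u n - l); rewrite subKr; have := hu n; have := z1 n.
    lra.
  have le : l = h *: (y + l * l).
    apply/eqP; rewrite -subr_eq0; apply/eqP; apply: (@nm_small 2) => e e0.
    have [n [hn hn1]] := cvgs_shift hl e0.
    have -> : l - h *: (y + l * l) = h *: (u n * u n - l * l) - (u n.+1 - l).
      by rewrite /= !scalerDr scalerN; ncr.
    apply: le_trans (nmB _ _) _; rewrite nmh sqB.
    have := nmD (u n * (u n - l)) ((u n - l) * l).
    have := nmM (u n) (u n - l); have := nmM (u n - l) l.
    have := nm_ge0 (u n - l); have := nm_ge0 l; have := nm_ge0 (u n).
    have := hu n; have := z1 n.
    move: hn hn1; set q := nm (u n - l); nra.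
  exists (1 - l); split.
  + by rewrite /selfadj stB st1 lsa.
  + have -> : (1 - l) * (1 - l) = 1 - (l + l) + l * l by ncr.
    rewrite {1 2}le -scalerDl (_ : h + h = 1) ?scale1r; first by ncr.
    by rewrite /h -rmorphD /= (_ : 2^-1 + 2^-1 = 1 :> R) //; lra.
  + by rewrite subKr.
  + by move=> w /lcomm lw; rewrite mulrBl mulrBr lw mul1r mulr1.
elim: n m => [|n ih] m; first by rewrite !subr0 hu.
case: m => [|m] // nm_.
rewrite /= -scalerBr nmh -mulrBr ler_wpM2l ?invr_ge0 //.
rewrite !addKBl sqB; apply: le_trans (nmD _ _) _.
have := ih _ nm_; have := hu m; have := hu n.
have := nmM (u m) (u m - u n); have := nmM (u m - u n) (u n).
have := nm_ge0 (u m); have := nm_ge0 (u n); have := nm_ge0 (u m - u n).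
have := z0 m; have := z0 n; nra.
Qed.
End Complete.

(** * Spectral radius of self-adjoint elements *)

Section Spectrum.
Variables (R : realType) (A : cstarAlg R).
Implicit Types a b c x y z : A.

Lemma Re_norm_real (k : R) : complex.Re `|k%:C| = `|k|.
Proof. by rewrite normc_def /= expr0n addr0 sqrtr_sqr. Qed.

Lemma Re_norm_imag (k : R) : complex.Re `|('i%R : R[i]) * k%:C| = `|k|.
Proof.
by rewrite -(complexiE R) normc_def /= !mul0r !mulr0 subr0 expr0n /= !add0r sqrtr_sqr mul1r.
Qed.

(** For commuting self-adjoint x and y, the product of x + iy with its adjoint is x^2 + y^2, and the
    C*-identity applies. *)
Lemma nm_cart2 x y : selfadj x -> selfadj y -> x * y = y * x ->
  nm (x + 'i%R *: y) ^+ 2 = nm (x * x + y * y).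
Proof.
move=> xs ys xy; rewrite -nmstM stD stZi xs ys.
rewrite mulrDl !mulrDr !mulNr -!scalerAl -!scalerAr xy scalerA -[_ * 'i%R]expr2 sqrCi scaleN1r.
by congr nm; ncr.
Qed.

Lemma resolvent_out a (l : R[i]) : nm a < complex.Re `|l| -> a - l%:A \is a GRing.unit.
Proof.
move=> h.
have l0 : l != 0 by apply: contraTneq h => ->; rewrite normr0 -leNgt nm_ge0.
have -> : a - l%:A = (- l) *: (1 - l^-1 *: a).
  by rewrite scalerBr scalerA mulNr divff // scaleN1r scaleNr opprK addrC.
rewrite scaler_unit ?unitrN ?unitfE //; apply: neumann.
rewrite nmZ; have nl : 0 < complex.Re `|l| by apply: le_lt_trans h; rewrite nm_ge0.
have : complex.Re `|l^-1| * complex.Re `|l| = 1.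
  rewrite -[RHS]/(complex.Re (1 : R[i])) -(normr1 R[i]) -(mulVf l0) normrM.
  by rewrite !normc_def /= mulr0 subr0.
set u := complex.Re `|l^-1|; set v := complex.Re `|l| in h nl *; move=> uv.
have u0 : 0 < u by rewrite -(pmulr_lgt0 _ nl) uv ltr01.
by rewrite -uv ltr_pM2l.
Qed.

Lemma sa_spectrum_real a (l : R[i]) : selfadj a -> spectrum a l -> l = (complex.Re l)%:C.
Proof.
move=> sa; case: l => al be /= hl; congr Complex; apply/eqP/negP => /negP b0; apply: hl.
pose a' := a - al%:C%:A; have sa' : selfadj a' by apply: saB => //; apply: saZ; exact: sa1.
(* Shift along the imaginary axis: if a' + it - i(be + t) were singular, then (be + t)^2 <= nm a'^2
   + t^2, i.e. be^2 + 2 be t <= nm a'^2. This t makes 2 be t = nm a'^2 + 1, a contradiction. *)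
pose t := (nm a' ^+ 2 + 1) / (be *+ 2).
have -> : a - (al +i* be)%:A = (a' + 'i%R *: t%:C%:A) - ('i%R * (be + t)%:C)%:A.
  rewrite (complexE (al +i* be)) /= scalerDl complexiE scalerA rmorphD mulrDr scalerDl.
  by rewrite /a'; ncr.
apply: resolvent_out; rewrite Re_norm_imag ltNge; apply/negP => h.
have h2 : (be + t) ^+ 2 <= nm (a' + 'i%R *: t%:C%:A) ^+ 2.
  by rewrite -[leLHS]real_normK ?num_real // ler_pXn2r ?nnegrE ?nm_ge0.
move: h2; rewrite nm_cart2 //; last 2 first.
- by apply: saZ; exact: sa1.
- by rewrite -scalerAl -scalerAr mulr1 mul1r.
have -> : t%:C%:A * t%:C%:A = (t ^+ 2)%:C%:A :> A by rewrite -scalerAl mul1r scalerA -rmorphM.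
move=> /le_trans/(_ (nmD _ _)); rewrite nm_alg nm_sa2 // ger0_norm ?sqr_ge0 //.
have : 2 * be * t = nm a' ^+ 2 + 1.
  by rewrite /t; field; rewrite b0.
have := sqr_ge0 be; nra.
Qed.

(* The contraction a satisfies a^2 + r^2 = 1 with r invertible, so a^2 = b^2/(1+b^2)
   for b = a/r; with T > ||b||^2, the difference T/(1+T) - a^2 is again a square e^2,
   whence ||a||^2 <= ||a + ie||^2 = T/(1+T) < 1. *)
Lemma nm_lt1_of_unit a : selfadj a -> nm a <= 1 -> 1 - a * a \is a GRing.unit -> nm a < 1.
Proof.
move=> sa a1 ua.
have sa2 : selfadj (a * a) by apply: saM.
have a2 : nm (a * a) <= 1 by rewrite nm_sa2 // expr_le1 ?nm_ge0.
have [r [rs r2 _ rc]] := sqrt_iter sa2 a2.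
have ar : a * r = r * a by symmetry; apply: rc; rewrite mulrA.
have ur : r \is a GRing.unit by rewrite -(unitrX_pos r (n := 2)) // expr2 r2.
have [b bE] : exists b, b = a * r^-1 by exists (a * r^-1).
have aV : a * r^-1 = r^-1 * a by apply: commrV.
have bs : selfadj b by rewrite bE; apply: saM => //; apply: saV.
have br : b * r = r * b by rewrite bE -mulrA mulVr // aV mulrA divrr // mulr1 mul1r.
have bba : b * b * (r * r) = a * a.
  have -> : b * b * (r * r) = b * (b * r) * r by rewrite !mulrA.
  have ba : b * r = a by rewrite bE -mulrA mulVr ?mulr1.
  by rewrite ba -mulrA ar mulrA ba.
pose T := nm b ^+ 2 + 1; have T0 : 0 < T by rewrite ltr_pwDr ?sqr_ge0.
have [||g [gs g2 _ gc]] := @sqrt_iter _ _ (T^-1%:C *: (b * b)).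
- by apply: saZ; apply: saM.
- rewrite nmZr nm_sa2 // ger0_norm ?invr_ge0 ?(ltW T0) // ler_pdivrMl // mulr1.
  by rewrite lerDl.
have rbb : b * b * r = r * (b * b) by rewrite -mulrA br !mulrA br.
have abb : b * b * a = a * (b * b).
  have ab : a * b = b * a by rewrite bE {1}aV mulrA.
  by rewrite !mulrA ab -!mulrA ab.
have gr : g * r = r * g by apply: gc; rewrite -scalerAl -scalerAr rbb.
have ga : g * a = a * g by apply: gc; rewrite -scalerAl -scalerAr abb.
pose q := T / (1 + T); have q0 : 0 <= q by apply: divr_ge0; lra.
have q1 : q < 1 by rewrite ltr_pdivrMr; lra.
pose e := (Num.sqrt q)%:C *: (g * r).
have es : selfadj e by apply: saZ; apply: saM.
have ae : a * e = e * a by rewrite -scalerAl -scalerAr -mulrA -ar !mulrA ga.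
have e2 : a * a + e * e = q%:C%:A.
  have -> : e * e = q%:C *: (g * g * (r * r)).
    rewrite -scalerAl -scalerAr scalerA -rmorphM /= -expr2 sqr_sqrtr //.
    by congr (_ *: _); rewrite !mulrA -[g * r * g]mulrA -gr !mulrA.
  rewrite g2 mulrBl mul1r -scalerAl bba r2 scalerBr scalerBr scalerA -rmorphM /=.
  have -> : q * T^-1 = 1 - q by rewrite /q; field; rewrite !gt_eqF //; lra.
  by rewrite rmorphB scalerBl rmorph1 scale1r; ncr.
have := nm_cart2 sa es ae; rewrite e2 nm_alg ger0_norm // => N2.
have h : nm a <= nm (a + 'i%R *: e).
  have := nmD (a + 'i%R *: e) (cstar (a + 'i%R *: e)).
  rewrite nmst stD stZi sa es addrACA subrr addr0.
  have -> : a + a = (2 : R)%:C *: a by rewrite (_ : 2 = 1 + 1) // rmorphD scalerDl rmorph1 scale1r.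
  by rewrite nmZr ger0_norm //; lra.
have := nm_ge0 a; nra.
Qed.

End Spectrum.

(** * The positive cone *)

Section Positive.
Variables (R : realType) (A : cstarAlg R).
Implicit Types a b c x y z w r : A.

Lemma alg_sa (k : R) : selfadj (k%:C%:A : A).
Proof. by apply: saZ; exact: sa1. Qed.

Lemma algC (k : R[i]) a : k%:A * a = a * k%:A.
Proof. by rewrite mulr_algl mulr_algr. Qed.

Lemma posI a : selfadj a -> (forall k : R, k < 0 -> a - k%:C%:A \is a GRing.unit) ->
  positive a.
Proof.
move=> sa h; split=> // l hl; rewrite (sa_spectrum_real sa hl) ler0c leNgt.
apply/negP => /h ul; by apply: (hl); rewrite (sa_spectrum_real sa hl).
Qed.

Lemma pos_unit a (k : R) : positive a -> k < 0 -> a - k%:C%:A \is a GRing.unit.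
Proof.
move=> [_ h] k0; apply: contrapT => /h; rewrite ler0c; by rewrite leNgt k0.
Qed.

Lemma pos_sa a : positive a -> selfadj a.
Proof. by case. Qed.

Lemma sa_unit_out a (k : R) : selfadj a -> nm a < `|k| -> a - k%:C%:A \is a GRing.unit.
Proof. by move=> sa h; apply: resolvent_out; rewrite Re_norm_real. Qed.

(** The norm of a self-adjoint element is bounded by its spectral radius. If r < nm a, then after
    scaling to norm 1 both 1 - a1 and 1 + a1 are invertible, hence so is 1 - a1^2, and
    [nm_lt1_of_unit] contradicts the normalisation. *)
Lemma nm_le_spectrum a (r : R) : selfadj a -> 0 <= r ->
  (forall k : R, r < `|k| -> a - k%:C%:A \is a GRing.unit) -> nm a <= r.
Proof.
move=> sa r0 h; rewrite leNgt; apply/negP => ra.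
have N0 : 0 < nm a by apply: le_lt_trans ra.
pose s := (nm a)^-1%:C; pose a1 := s *: a.
have n1 : nm a1 = 1 by rewrite /a1 nmZr ger0_norm ?invr_ge0 ?nm_ge0 // mulVf ?gt_eqF.
suff : nm a1 < 1 by rewrite n1 ltxx.
have sN : s * (nm a)%:C = 1 by rewrite /s -rmorphM /= mulVf ?gt_eqF ?rmorph1.
have us : s \is a GRing.unit.
  by rewrite unitfE; apply: contra_eq_neq sN => ->; rewrite mul0r eq_sym oner_neq0.
apply: nm_lt1_of_unit; [exact: saZ | by rewrite n1 |].
have -> : 1 - a1 * a1 = - (a1 - 1) * (a1 + 1) by ncr.
have e1 : (1 : A) = s *: (nm a)%:C%:A by rewrite scalerA sN scale1r.
rewrite unitrMl ?unitrN; rewrite {1}e1 -?scalerBr -?scalerDr scaler_unit //.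
  by apply: h; rewrite gtr0_norm.
rewrite -[_%:A]opprK -scaleNr -rmorphN; apply: h.
by rewrite normrN gtr0_norm.
Qed.

(** The spectrum of t - a lies in [0, t]. Together with the converse [nm_pos], this turns positivity
    into a norm inequality, so that sums of positive elements are handled by the triangle
    inequality. *)
Lemma pos_nm a (t : R) : positive a -> nm a <= t -> nm (t%:C%:A - a) <= t.
Proof.
move=> pa at_; apply: nm_le_spectrum; first by apply: saB; [exact: alg_sa|exact: pos_sa].
  exact: le_trans (nm_ge0 a) at_.
move=> k hk; have -> : t%:C%:A - a - k%:C%:A = - (a - (t - k)%:C%:A).
  by rewrite rmorphB scalerBl; ncr.
rewrite unitrN; case: (ltP (t - k) 0) => tk; first exact: pos_unit.
apply: sa_unit_out; first exact: pos_sa.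
rewrite ger0_norm //; apply: le_lt_trans at_ _.
have := ler_norm k; case: (ltP k 0) => k0; first by lra.
rewrite ger0_norm // in hk; lra.
Qed.

Lemma nm_pos a (t : R) : selfadj a -> nm (t%:C%:A - a) <= t -> positive a.
Proof.
move=> sa h; apply: posI => // k k0.
have -> : a - k%:C%:A = - ((t%:C%:A - a) - (t - k)%:C%:A).
  by rewrite rmorphB scalerBl; ncr.
rewrite unitrN; apply: sa_unit_out; first by apply: saB => //; exact: alg_sa.
have := ler_norm (t - k); lra.
Qed.

Lemma posD a b : positive a -> positive b -> positive (a + b).
Proof.
move=> pa pb; apply: (@nm_pos _ (nm a + nm b)); first by apply: saD; exact: pos_sa.
have -> : (nm a + nm b)%:C%:A - (a + b) = ((nm a)%:C%:A - a) + ((nm b)%:C%:A - b).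
  by rewrite rmorphD scalerDl; ncr.
by apply: le_trans (nmD _ _) _; apply: lerD; apply: pos_nm.
Qed.

Lemma pos_alg (k : R) : 0 <= k -> positive (k%:C%:A : A).
Proof.
move=> k0; apply: (@nm_pos _ k); first exact: alg_sa.
by rewrite subrr nm0.
Qed.

Lemma pos0 : positive (0 : A).
Proof. by have := pos_alg (lexx 0); rewrite scale0r. Qed.

Lemma posZ (k : R) a : 0 <= k -> positive a -> positive (k%:C *: a).
Proof.
move=> k0 pa; apply: (@nm_pos _ (k * nm a)); first by apply: saZ; exact: pos_sa.
rewrite rmorphM -scalerA -scalerBr nmZr ger0_norm //.
by rewrite ler_wpM2l // pos_nm.
Qed.

Lemma pos_anti a : positive a -> positive (- a) -> a = 0.
Proof.
move=> pa na; apply: nm_eq0; apply/eqP; rewrite eq_le nm_ge0 andbT.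
apply: nm_le_spectrum => //; first exact: pos_sa.
move=> k; rewrite normr_gt0 neq_lt => /orP[] k0; first exact: pos_unit.
have -> : a - k%:C%:A = - (- a - (- k)%:C%:A) by rewrite rmorphN scaleNr; ncr.
by rewrite unitrN; apply: pos_unit => //; rewrite oppr_lt0.
Qed.

(** Rescale the root that [sqrt_iter] gives for y = 1 - a / nm a, which has norm at most 1 by
    [pos_nm]; the bound on 1 - r makes r positive. *)
Lemma pos_sqrt a : positive a -> exists r : A, [/\ positive r, r * r = a &
  forall w, a * w = w * a -> r * w = w * r].
Proof.
move=> pa; have [->|a0] := eqVneq a 0.
  by exists 0; split; [exact: pos0|rewrite mulr0|move=> *; rewrite mul0r mulr0].
have N0 := nm_gt0 a0; pose s := (nm a)^-1%:C.
have sN : s * (nm a)%:C = 1 by rewrite /s -rmorphM /= mulVf ?gt_eqF ?rmorph1.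
have e1 : (1 : A) = s *: (nm a)%:C%:A by rewrite scalerA sN scale1r.
have [||r [rs r2 r1 rc]] := @sqrt_iter _ _ (1 - s *: a).
- by apply: saB; [exact: sa1|apply: saZ; exact: pos_sa].
- rewrite e1 -scalerBr nmZr ger0_norm ?invr_ge0 ?nm_ge0 // ler_pdivrMl // mulr1.
  exact: pos_nm.
exists ((Num.sqrt (nm a))%:C *: r); split.
- apply: posZ; first exact: sqrtr_ge0.
  by apply: (@nm_pos _ 1) => //; rewrite scale1r.
- rewrite -scalerAl -scalerAr scalerA -rmorphM /= -expr2 sqr_sqrtr ?nm_ge0 // r2.
  by rewrite subKr scalerA mulrC sN scale1r.
- move=> w aw; rewrite -scalerAl -scalerAr rc //.
  by rewrite mulrBl mulrBr mul1r mulr1 -scalerAl -scalerAr aw.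
Qed.

(** For k = -m^2 < 0, the element r^2 - k factors as (r - im)(r + im), and both factors are
    invertible because the spectrum of r is real. *)
Lemma pos_sq r : selfadj r -> positive (r * r : A).
Proof.
move=> sr; apply: posI; first exact: saM.
move=> k k0; pose m := Num.sqrt (- k).
have m0 : 0 < m by rewrite sqrtr_gt0 oppr_gt0.
have u (s : R) : s != 0 -> r - ('i%R * s%:C)%:A \is a GRing.unit.
  move=> s0; apply: contrapT => h; have := sa_spectrum_real sr h.
  by rewrite -(complexiE R) => /(congr1 (@complex.Im R)) /=; rewrite mul0r add0r mul1r => /eqP; rewrite (negbTE s0).
have -> : r * r - k%:C%:A = (r - ('i%R * m%:C)%:A) * (r - ('i%R * (- m)%:C)%:A).
  rewrite rmorphN mulrN scaleNr opprK mulrDr !mulrBl algC.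
  have -> : ('i%R * m%:C)%:A * ('i%R * m%:C)%:A = k%:C%:A :> A.
    rewrite mulr_algl scalerA mulrACA -!expr2 sqrCi -rmorphXn /= sqr_sqrtr ?oppr_ge0 ?ltW //.
    by rewrite rmorphN mulN1r opprK.
  by ncr.
by rewrite unitrMl; apply: u; rewrite ?oppr_eq0 gt_eqF.
Qed.

Lemma pos_part b : selfadj b -> exists p n : A,
  [/\ positive p, positive n, b = p - n & p * n = 0 /\ n * p = 0].
Proof.
move=> sb; have [d [pd d2 dc]] := pos_sqrt (pos_sq sb).
have db : d * b = b * d by apply: dc; rewrite mulrA.
pose h : R[i] := (2^-1 : R)%:C.
have hh x : h *: x + h *: x = x.
  by rewrite -scalerDl /h -rmorphD /= (_ : 2^-1 + 2^-1 = 1 :> R) ?rmorph1 ?scale1r //; lra.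
pose p := h *: (d + b); pose n := h *: (d - b).
have pn : p * n = 0.
  by rewrite -scalerAl -scalerAr mulrBr !mulrDl d2 db [_ + b * b]addrC subrr !scaler0.
have np : n * p = 0.
  by rewrite -scalerAl -scalerAr mulrDr !mulrBl d2 db subrKA subrr !scaler0.
have pn_d : p + n = d by rewrite -scalerDr addrACA subrr addr0 scalerDr hh.
have sd := pos_sa pd.
(* Since xy = yx = 0 and x + y = d, the product (x - k)(y - k) equals -k(d - k), which is invertible
   for k < 0; its commuting factors are then invertible too. *)
have key x y : selfadj x -> x * y = 0 -> y * x = 0 -> x + y = d -> positive x.
  move=> sx xy yx xyd; apply: posI => // k k0.
  have u : - (k%:C *: (d - k%:C%:A)) \is a GRing.unit.
    rewrite unitrN scaler_unit; first exact: pos_unit.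
    by rewrite unitfE -[0]/(0%:C) (inj_eq (@complexI R)) lt_eqF.
  have e1 : (x - k%:C%:A) * (y - k%:C%:A) = - (k%:C *: (d - k%:C%:A)).
    rewrite mulrBr !mulrBl xy mulr_algl mulr_algr mulr_algr -xyd scalerBr scalerDr.
    by ncr.
  have e2 : (y - k%:C%:A) * (x - k%:C%:A) = - (k%:C *: (d - k%:C%:A)).
    rewrite mulrBr !mulrBl yx mulr_algl mulr_algr mulr_algr -xyd scalerBr scalerDr.
    by ncr.
  have : (x - k%:C%:A) * (y - k%:C%:A) \is a GRing.unit by rewrite e1.
  by rewrite unitrM_comm => [/andP[]|]; rewrite ?/GRing.comm ?e1 ?e2.
exists p, n; split => //.
- by apply: (key p n) => //; apply: saZ; apply: saD.
- by apply: (key n p) => //; [apply: saZ; apply: saB|rewrite addrC].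
- rewrite /p /n -scalerBr (_ : d + b - (d - b) = b + b) ?scalerDr ?hh //.
  by ncr.
Qed.
End Positive.

(** * The operator order *)

Section Order.
Variables (R : realType) (A : cstarAlg R).
Implicit Types a b c d x y z w r v f g : A.

(** The products xy and yx have the same nonzero spectrum: if v inverts xy - K, then L(yvx - 1)
    inverts yx - K. Here K is a central unit with inverse L. *)
Lemma jacobson (B : unitRingType) (x y K L : B) :
  (forall z : B, K * z = z * K) -> L * K = 1 ->
  x * y - K \is a GRing.unit -> y * x - K \is a GRing.unit.
Proof.
move=> cK LK /unitrP[v [vl vr]].
have vl' : v * x * y = 1 + K * v by rewrite -vl mulrBr cK mulrA subrK.
have vr' : x * y * v = 1 + K * v by rewrite -vr mulrBl subrK.
have KL : K * L = 1 by rewrite cK.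
have cL (z : B) : L * z = z * L.
  by rewrite -[LHS]mulr1 -KL mulrA -[L * z * K]mulrA -cK mulrA LK mul1r.
apply/unitrP; exists (L * (y * v * x - 1)); split.
  have -> : L * (y * v * x - 1) * (y * x - K)
     = L * (y * (v * x * y) * x - y * v * (x * K) - y * x + K) by ncr.
  by rewrite vl' -cK -[RHS]LK; congr (_ * _); rewrite [K * v]cK; ncr.
rewrite mulrA -cL -mulrA -[RHS]LK.
congr (_ * _); have -> : (y * x - K) * (y * v * x - 1) =
   y * (x * y * v) * x - K * y * v * x - y * x + K by ncr.
by rewrite vr' [K * y]cK; ncr.
Qed.

Lemma stM_eq0 c : cstar c * c = 0 -> c = 0.
Proof.
move=> h; apply: nm_eq0; apply/eqP; rewrite -sqrf_eq0 -nmstM h nm0; exact: eqxx.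
Qed.

Lemma sa_sq_eq0 a : selfadj a -> a * a = 0 -> a = 0.
Proof. by move=> sa h; apply: stM_eq0; rewrite sa. Qed.

Lemma pos_half x : positive (x + x) -> positive x.
Proof.
have h0 : (0 : R) <= 2^-1 by rewrite invr_ge0.
move=> /(posZ h0); rewrite scalerDr -scalerDl -rmorphD /=.
by rewrite (_ : 2^-1 + 2^-1 = 1 :> R) ?rmorph1 ?scale1r //; lra.
Qed.

(* With b = c^*c = p - n, the element d = cn has d^*d = -n^3 <= 0, hence also dd^* <= 0,
   while d^*d + dd^* is a sum of squares. *)
Lemma pos_stM c : positive (cstar c * c).
Proof.
have sb : selfadj (cstar c * c) by rewrite /selfadj stM stK.
have [p [n [pp pn bE [pn0 np0]]]] := pos_part sb.
suff n0 : n = 0 by rewrite bE n0 subr0.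
have sn := pos_sa pn.
pose d := c * n.
have dd : cstar d * d = - (n * n * n).
  rewrite /d stM sn -mulrA [_ * (c * n)]mulrA bE.
  by rewrite mulrBl pn0 sub0r mulrN mulrA.
have nnn : positive (n * n * n).
  have [r [pr r2 rc]] := pos_sqrt pn.
  have rn : r * n = n * r by apply: rc.
  have -> : n * n * n = (r * n) * (r * n) by rewrite -[RHS]mulrA [n * (r * n)]mulrA -rn !mulrA r2.
  by apply: pos_sq; apply: saM => //; exact: pos_sa.
have ndd : positive (- (d * cstar d)).
  apply: posI; first by rewrite /selfadj stN stM stK.
  move=> k k0; rewrite -mulNr; apply: (@jacobson _ _ _ _ k^-1%:C%:A).
  - exact: algC.
  - by rewrite mulr_algl scalerA -rmorphM /= mulVf ?lt_eqF // rmorph1 scale1r.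
  by rewrite mulrN dd opprK; apply: pos_unit.
have s1 : positive ((d + cstar d) * (d + cstar d)).
  by apply: pos_sq; rewrite /selfadj stD stK addrC.
have s2 : positive (- ((d - cstar d) * (d - cstar d))).
  have -> : - ((d - cstar d) * (d - cstar d)) = ('i%R *: (d - cstar d)) * ('i%R *: (d - cstar d)).
    by rewrite -scalerAl -scalerAr scalerA -[_ * 'i%R]expr2 sqrCi scaleN1r.
  by apply: pos_sq; rewrite /selfadj stZi stB stK -scalerN opprB.
have pdd : positive (cstar d * d).
  apply: pos_half.
  have := posD (posD s1 s2) (posD ndd ndd).
  by congr positive; ncr.
have dd0 : cstar d * d = 0 by apply: pos_anti => //; rewrite dd opprK.
have n30 : n * n * n = 0 by rewrite -[LHS]opprK -dd dd0 oppr0.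
have n20 : n * n = 0 by apply: sa_sq_eq0; [exact: saM | rewrite mulrA n30 mul0r].
exact: sa_sq_eq0.
Qed.

Lemma pos_conj w a : positive a -> positive (cstar w * a * w).
Proof.
move=> pa; have [r [pr <- _]] := pos_sqrt pa.
by have := pos_stM (r * w); rewrite stM (pos_sa pr) !mulrA.
Qed.

Lemma ople_refl a : ople a a.
Proof. by rewrite /ople subrr; exact: pos0. Qed.

Lemma ople_trans b a c : ople a b -> ople b c -> ople a c.
Proof. by move=> h1 h2; have := posD h2 h1; rewrite addrA subrK. Qed.

Lemma ople_anti a b : ople a b -> ople b a -> a = b.
Proof.
move=> h1 h2; apply/eqP; rewrite -subr_eq0; apply/eqP.
by apply: pos_anti h2 _; rewrite opprB.
Qed.

Lemma le_nm a (t : R) : selfadj a -> nm a <= t -> positive (t%:C%:A - a).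
Proof.
move=> sa h; apply: (@nm_pos _ _ _ t); first by apply: saB => //; exact: alg_sa.
by rewrite subKr.
Qed.

Lemma alg_pos_ge0 (k : R) : positive (k%:C%:A : A) -> 0 <= k.
Proof.
move=> [_ h]; rewrite -ler0c; apply: h; rewrite /spectrum /= subrr.
by rewrite unitr0.
Qed.

Lemma nm_le a (t : R) : positive a -> positive (t%:C%:A - a) -> nm a <= t.
Proof.
move=> pa h; have t0 : 0 <= t by apply: alg_pos_ge0; rewrite -(subrK a t%:C%:A); apply: posD.
apply: nm_le_spectrum => //; first exact: pos_sa.
move=> k; case: (ltP k 0) => [k0 _|k0]; first exact: pos_unit.
rewrite ger0_norm // => tk.
have -> : a - k%:C%:A = - ((t%:C%:A - a) - (t - k)%:C%:A).
  by rewrite rmorphB scalerBl; ncr.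
by rewrite unitrN; apply: pos_unit => //; rewrite subr_lt0.
Qed.

Lemma nm_mono a b : positive a -> ople a b -> nm a <= nm b.
Proof.
move=> pa ab; apply: nm_le => //; apply: (@ople_trans b) => //; apply: le_nm => //.
by rewrite -(subrK a b); apply: saD; apply: pos_sa.
Qed.

Lemma pos_eps a : (forall e : R, 0 < e -> positive (e%:C%:A + a)) -> positive a.
Proof.
move=> h; have sa : selfadj a.
  by rewrite -(addKr (1%:C%:A) a) addrC; apply: saB; [exact: pos_sa (h _ ltr01) | exact: alg_sa].
apply: posI => // k k0; have e0 : 0 < - k / 2 by lra.
have -> : a - k%:C%:A = ((- k / 2)%:C%:A + a) - (k / 2)%:C%:A.
  have -> : - k / 2 = k / 2 - k by field.
  by rewrite [(_ - k)%:C]rmorphB scalerBl; ncr.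
by apply: pos_unit; [exact: h | lra].
Qed.

(** Serves to discard second-order terms after division by t; the t chosen in the proof satisfies t
    b <= e. *)
Lemma pos_limit a b (t0 : R) : 0 < t0 -> selfadj b ->
  (forall t : R, 0 < t -> t <= t0 -> positive (t%:C *: b + a)) -> positive a.
Proof.
move=> t00 sb h; apply: pos_eps => e e0.
pose t := Num.min t0 (e / (nm b + 1)).
have nb : 0 < nm b + 1 by have := nm_ge0 b; lra.
have tpos : 0 < t by rewrite lt_min t00 divr_gt0.
have tb : t * nm b <= e.
  apply: (@le_trans _ _ (t * (nm b + 1))); first by rewrite ler_pM2l //; lra.
  by rewrite -ler_pdivlMr // ge_min lexx orbT.
have -> : e%:C%:A + a = (t%:C *: b + a) + (e%:C%:A - t%:C *: b) by ncr.
apply: posD; first by apply: h => //; rewrite ge_min lexx.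
by apply: le_nm; [exact: saZ | rewrite nmZr gtr0_norm].
Qed.

Lemma sq_le_nm v : positive v -> positive ((nm v)%:C *: v - v * v).
Proof.
move=> pv; have [r [pr r2 rc]] := pos_sqrt pv.
have := pos_conj r (le_nm (pos_sa pv) (lexx (nm v))).
rewrite (pos_sa pr) mulrBr mulrBl mulr_algr -scalerAl r2.
by rewrite rc // -mulrA r2.
Qed.

(** From vxv <= nm x v^2 and v^2 <= nm v v. The bound is a multiple of v rather than of 1, so
    second-order perturbations stay below any h dominating v. *)
Lemma conj_le_nm v x : positive v -> positive x ->
  positive ((nm x * nm v)%:C *: v - v * x * v).
Proof.
move=> pv px.
have h1 := pos_conj v (le_nm (pos_sa px) (lexx (nm x))).
have h2 := posZ (nm_ge0 x) (sq_le_nm pv).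
have := posD h1 h2; rewrite (pos_sa pv) mulrBr mulrBl mulr_algr -scalerAl.
by rewrite scalerBr scalerA -rmorphM addrC addrA subrK.
Qed.

Lemma oplt_eps a b : oplt a b -> exists2 e : R, 0 < e & ople (a + e%:C%:A) b.
Proof.
case=> pd ud; set d := b - a in pd ud.
have nd : 0 < nm d^-1 + 1 by have := nm_ge0 d^-1; lra.
(* With this e, any k < 0 with e + k >= 0 satisfies (e + k) nm d^-1 < 1, so d - (e + k) is still
   invertible by the Neumann series. *)
exists (nm d^-1 + 1)^-1; first by rewrite invr_gt0.
set e := (nm d^-1 + 1)^-1.
have -> : ople (a + e%:C%:A) b = positive (d - e%:C%:A) by rewrite /ople opprD addrA.
apply: posI => [|k k0]; first by apply: saB; [exact: pos_sa|exact: alg_sa].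
have -> : d - e%:C%:A - k%:C%:A = d - (e + k)%:C%:A by rewrite rmorphD scalerDl opprD addrA.
case: (ltP (e + k) 0) => ek; first exact: pos_unit.
apply: (unit_near ud); rewrite addrAC subrr add0r nmN nm_alg ger0_norm //.
have e1 : e * (nm d^-1 + 1) = 1 by rewrite mulVf ?gt_eqF.
have := nm_ge0 d^-1; have : 0 < e by rewrite invr_gt0.
nra.
Qed.

Lemma eps_oplt a b (e : R) : 0 < e -> ople (a + e%:C%:A) b -> oplt a b.
Proof.
move=> e0; rewrite /ople opprD addrA => h; rewrite /oplt.
rewrite -(subrK e%:C%:A (b - a)); split.
  by apply: posD => //; apply: pos_alg; exact: ltW.
have -> : b - a - e%:C%:A + e%:C%:A = (b - a - e%:C%:A) - (- e)%:C%:A.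
  by rewrite rmorphN scaleNr opprK.
by apply: pos_unit => //; rewrite oppr_lt0.
Qed.

Definition cproj (f : A) : Prop := projection f /\ central f.

Lemma cprojC f : cproj f -> cproj (1 - f).
Proof.
move=> [[ff sf] cf]; split; last by move=> x; rewrite mulrBl mulrBr cf mul1r mulr1.
by split; [rewrite mulrBl mul1r mulrBr mulr1 ff subrr subr0 | rewrite stB st1 sf].
Qed.

Lemma cprojM f g : cproj f -> cproj g -> cproj (f * g).
Proof.
move=> [[ff sf] cf] [[gg sg] cg]; split.
  by split; [rewrite -mulrA [g * _]cg -!mulrA gg mulrA ff | rewrite stM sf sg cg].
by move=> x; rewrite -mulrA cg mulrA cf -mulrA.
Qed.

Lemma cproj_pos f a : cproj f -> positive a -> positive (f * a).
Proof.
by move=> [[ff sf] cf] /(pos_conj f); rewrite sf -mulrA -cf mulrA ff.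
Qed.

Lemma cproj_split f a : cproj f -> positive (f * a) -> positive ((1 - f) * a) -> positive a.
Proof. by move=> cf h1 h2; have := posD h1 h2; rewrite -mulrDl addrC subrK mul1r. Qed.

End Order.

(** * Suprema and central separation *)

Section Comparison.
Variables (R : realType) (A : cstarAlg R).
Implicit Types a b c d x y z w r u v f g h m n : A.

Lemma span_sa (Q : A -> Prop) :
  (forall a b, Q a -> Q b -> Q (a + b)) -> (forall (k : R[i]) a, Q a -> Q (k *: a)) ->
  (forall a, selfadj a -> Q a) -> forall a, Q a.
Proof.
move=> QD QZ Qs a.
have -> : a = (2^-1)%:C *: ((a + cstar a) + (- 'i%R) *: ('i%R *: (a - cstar a))).
  rewrite scalerA mulNr -expr2 sqrCi opprK scale1r.
  have -> : a + cstar a + (a - cstar a) = a + a by ncr.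
  rewrite scalerDr -scalerDl -rmorphD /=.
  by rewrite (_ : 2^-1 + 2^-1 = 1 :> R) ?rmorph1 ?scale1r //; lra.
apply/QZ/QD; last apply: QZ; apply: Qs; first by rewrite /selfadj stD stK addrC.
by rewrite /selfadj stZi stB stK -scalerN opprB.
Qed.

Lemma span_unit_interval (Q : A -> Prop) :
  (forall a b, Q a -> Q b -> Q (a + b)) -> (forall (k : R[i]) a, Q a -> Q (k *: a)) ->
  (forall a, positive a -> ople a 1 -> Q a) -> forall a, Q a.
Proof.
move=> QD QZ Qp; apply: span_sa => // a sa.
have N0 : 0 < nm a + 1 by have := nm_ge0 a; lra.
have aN : nm a <= nm a + 1 by lra.
set N := nm a + 1 in N0 aN.
have e1 : (1 : A) = (2^-1 * N^-1)%:C *: ((N + N)%:C)%:A.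
  by rewrite scalerA -rmorphM /= (_ : _ * _ = 1) ?rmorph1 ?scale1r //; field; rewrite gt_eqF.
have k0 : 0 <= 2^-1 * N^-1 by rewrite mulr_ge0 ?invr_ge0 // ltW.
pose b := (2^-1 * N^-1)%:C *: (N%:C%:A + a).
have pb : positive b.
  by apply: posZ => //; rewrite -[a]opprK; apply: le_nm; [exact: saN|rewrite nmN].
have b1 : ople b 1.
  rewrite /ople e1 -scalerBr; apply: posZ => //.
  have -> : (N + N)%:C%:A - (N%:C%:A + a) = N%:C%:A - a by rewrite rmorphD scalerDl; ncr.
  exact: le_nm.
have -> : a = (2 * N)%:C *: b + (- N)%:C *: 1.
  rewrite scalerA -rmorphM /= (_ : _ * _ = 1) ?rmorph1 ?scale1r; last by field; rewrite gt_eqF.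
  by rewrite rmorphN scaleNr; ncr.
apply: (QD); apply: QZ; first exact: Qp.
apply: Qp; last exact: ople_refl.
by have := pos_alg A (@ler01 R); rewrite rmorph1 scale1r.
Qed.

(** As F is stable under right multiplication, ce annihilates F on the right for every c, so ece =
    ce. Taking adjoints gives ec = ece as well, and e is central. *)
Lemma annihilator (AW : AWstar A) (F : set A) : F !=set0 ->
  (forall b m, F b -> F (b * m)) ->
  exists e, [/\ cproj e, (forall b, F b -> b * e = 0) &
    forall a, (forall b, F b -> b * a = 0) -> e * a = a].
Proof.
move=> F0 FM; have [e [[ee se] eE]] := AW _ F0.
have eF a : (forall b, F b -> b * a = 0) <-> exists x, e * x = a.
  have -> : (forall b, F b -> b * a = 0) = [set a | forall b, F b -> b * a = 0] a by [].
  by rewrite eE; split=> [[x _ <-]|[x <-]]; [exists x|exists x].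
have e0 b : F b -> b * e = 0 by move: b; apply/eF; exists e.
have ea a : (forall b, F b -> b * a = 0) -> e * a = a.
  by move/eF => [x <-]; rewrite mulrA ee.
exists e; split=> //; split=> // a.
have ce c : e * (c * e) = c * e by apply: ea => b /(FM _ c)/e0; rewrite mulrA.
by rewrite -(ce a) -[in LHS](stK a) -[in LHS]se -stM -(ce (cstar a)) !stM stK se mulrA.
Qed.

(** The right ideal uA annihilates v; f generates its annihilator. *)
Lemma central_separation (AW : AWstar A) u v : (forall m, u * m * v = 0) ->
  exists f, [/\ cproj f, u * f = 0 & f * v = v].
Proof.
move=> uv; pose F : set A := [set b | exists m, b = u * m].
have [|b m [m' ->]|e [ce e0 ev]] := @annihilator AW F.
- by exists u, 1; rewrite mulr1.
- by exists (m' * m); rewrite mulrA.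
exists e; split=> //; first by rewrite -[u]mulr1; apply: e0; exists 1.
by apply: ev => _ [m ->].
Qed.

Definition is_sup (X : set A) b c s :=
  [/\ X s, ople b s, ople c s & forall t, X t -> ople b t -> ople c t -> ople s t].

Definition order_convex (X : set A) :=
  forall a b c, X a -> X b -> ople a c -> ople c b -> X c.

(* With E = umv + vm^*u, the element s - (E - P - Q) is again an upper bound of the pair,
   lying in X by the smallness assumption on m, hence it dominates s. *)
Lemma sup_perturb (X : set A) a h y z s m : order_convex X ->
  X a -> X (a + (h + h + h)) -> positive h ->
  positive y -> ople y h -> positive z -> ople z h -> is_sup X (a + y) (a + z) s ->
  let u := s - (a + y) in let v := s - (a + z) in
  let P := v * cstar m * u * m * v in let Q := u * m * v * cstar m * u in
  positive (h - (P + P + Q)) ->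
  positive (P + Q - (u * m * v + v * cstar m * u)).
Proof.
move=> cX Xa Xh ph py yh pz zh [Xs ys zs sl] u v P Q small.
have Xah : X (a + h).
  apply: (cX _ _ _ Xa Xh); rewrite /ople; first by rewrite addrC addKr.
  by rewrite [_ - _](_ : _ = h + h); [exact: posD|ncr].
have sh : ople s (a + h).
  by apply: sl => //; rewrite /ople addKBl.
have pu : positive u by [].
have pv : positive v by [].
have su := pos_sa pu; have sv := pos_sa pv.
have pP : positive P.
  have := pos_conj (m * v) pu; rewrite stM sv.
  by congr positive; rewrite /P !mulrA.
have pQ : positive Q.
  have := pos_conj (cstar m * u) pv; rewrite stM su stK.
  by congr positive; rewrite /Q !mulrA.
set E := u * m * v + v * cstar m * u.
have hD : ople s (s + (P + Q - E)).
  apply: sl.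
  - apply: (cX _ _ _ Xa Xh).
      have -> : s + (P + Q - E) = (a + y) + (u + P - E) + Q by rewrite /u; ncr.
      rewrite /ople.
      have -> : a + y + (u + P - E) + Q - a = y + (u + P - E) + Q by ncr.
      apply: posD => //; apply: posD => //.
      (* Completing the square: u + P - E is the conjugate of u by 1 - mv, and similarly with plus
         signs and with v in place of u below. *)
      have := pos_conj (1 - m * v) pu; congr positive.
      by rewrite stB st1 stM sv /P /E; ncr.
    rewrite /ople.
    have -> : a + (h + h + h) - (s + (P + Q - E)) =
      (a + h - s) + (h - u) + (u + P + E) + (h - (P + P + Q)) by ncr.
    apply: posD => //; apply: posD; first apply: posD => //.
      have -> : h - u = (a + h - s) + y by rewrite /u; ncr.
      exact: posD.
    have := pos_conj (1 + m * v) pu; congr positive.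
    by rewrite stD st1 stM sv /P /E; ncr.
  - rewrite /ople.
    have -> : s + (P + Q - E) - (a + y) = (u + P - E) + Q by rewrite /u; ncr.
    apply: posD => //; have := pos_conj (1 - m * v) pu; congr positive.
    by rewrite stB st1 stM sv /P /E; ncr.
  - rewrite /ople.
    have -> : s + (P + Q - E) - (a + z) = (v + Q - E) + P by rewrite /v; ncr.
    apply: posD => //; have := pos_conj (1 - cstar m * u) pv; congr positive.
    by rewrite stB st1 stM su stK /Q /E; ncr.
by move: hD; rewrite /ople addrC addKr.
Qed.

(** Apply [sup_perturb] to tm, divide by t and let t tend to 0: the first-order term umv + vm^*u is
    nonpositive. Passing to -m makes it 0, and passing to im gives umv - vm^*u = 0. *)
Lemma sup_orth (X : set A) a h y z s m : order_convex X ->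
  X a -> X (a + (h + h + h)) -> positive h ->
  positive y -> ople y h -> positive z -> ople z h -> is_sup X (a + y) (a + z) s ->
  (s - (a + y)) * m * (s - (a + z)) = 0.
Proof.
move=> cX Xa Xh ph py yh pz zh hs.
have [Xs ys zs sl] := hs.
have Xah : X (a + h).
  apply: (cX _ _ _ Xa Xh); rewrite /ople; first by rewrite addrC addKr.
  by rewrite [_ - _](_ : _ = h + h); [exact: posD|ncr].
have sh : ople s (a + h) by apply: sl => //; rewrite /ople addKBl.
set u := s - (a + y); set v := s - (a + z).
have pu : positive u by []. have pv : positive v by [].
have su := pos_sa pu; have sv := pos_sa pv.
have uh : ople u h.
  have -> : ople u h = positive ((a + h - s) + y) by congr positive; rewrite /u; ncr.
  exact: posD.
have vh : ople v h.
  have -> : ople v h = positive ((a + h - s) + z) by congr positive; rewrite /v; ncr.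
  exact: posD.
have neg w : positive (- (u * w * v + v * cstar w * u)).
  set P := v * cstar w * u * w * v; set Q := u * w * v * cstar w * u.
  have pconj : positive (cstar w * u * w) by apply: pos_conj.
  have qconj : positive (w * v * cstar w) by rewrite -{1}(stK w); apply: pos_conj.
  pose C1 := nm (cstar w * u * w) * nm v; pose C2 := nm (w * v * cstar w) * nm u.
  have C10 : 0 <= C1 by rewrite mulr_ge0 ?nm_ge0.
  have C20 : 0 <= C2 by rewrite mulr_ge0 ?nm_ge0.
  have hP : positive (C1%:C *: h - P).
    have := posD (posZ C10 vh) (conj_le_nm pv pconj); congr positive.
    by rewrite scalerBr -/C1 /P !mulrA; ncr.
  have hQ : positive (C2%:C *: h - Q).
    have := posD (posZ C20 uh) (conj_le_nm pu qconj); congr positive.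
    by rewrite scalerBr -/C2 /Q !mulrA; ncr.
  (* The summand 1 forces t <= 1 when t <= 1/C, so t^2 (C1 + C1 + C2) <= tC <= 1 and the smallness
     condition of [sup_perturb] holds for tw. *)
  pose C := 1 + C1 + C1 + C2; have C0 : 0 < C by rewrite /C; lra.
  apply: (@pos_limit _ _ _ (P + Q) C^-1); first by rewrite invr_gt0.
    rewrite /selfadj stD !stM !stK su sv /P /Q !mulrA; congr (_ + _).
  move=> t t0 tC.
  have tC1 : t * C <= 1 by rewrite -ler_pdivlMr // mul1r.
  have t2 : t * t * (C1 + C1 + C2) <= 1 by rewrite /C in tC1; nra.
  have := @sup_perturb X a h y z s (t%:C *: w) cX Xa Xh ph py yh pz zh hs.
  rewrite /= -/u -/v stZr.
  rewrite -!(scalerAl, scalerAr) !scalerA -!rmorphM /= -/P -/Q => h1.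
  have {h1} : positive ((t * t)%:C *: (P + Q) - t%:C *: (u * w * v + v * cstar w * u)).
    rewrite !scalerDr; apply: h1.
    have -> : h - ((t * t)%:C *: P + (t * t)%:C *: P + (t * t)%:C *: Q) =
      (t * t)%:C *: ((C1%:C *: h - P) + (C1%:C *: h - P) + (C2%:C *: h - Q))
      + (1 - t * t * (C1 + C1 + C2))%:C *: h.
      rewrite rmorphB rmorph1 scalerBl scale1r !mulrDr !rmorphD !rmorphM !scalerDl !scalerDr !scalerN !scalerA.
      by rewrite -!rmorphM; ncr.
    apply: posD; last by apply: posZ => //; lra.
    apply: posZ; first by rewrite mulr_ge0 ?ltW.
    by apply: posD => //; apply: posD.
  have ti : 0 <= t^-1 by rewrite invr_ge0 ltW.
  move/(posZ ti); rewrite scalerBr !scalerA -!rmorphM mulKf ?gt_eqF //.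
  by rewrite /= mulVf ?gt_eqF // rmorph1 scale1r.
have zer w : u * w * v + v * cstar w * u = 0.
  rewrite -[LHS]opprK; apply/eqP; rewrite oppr_eq0; apply/eqP; apply: pos_anti => //.
  have := neg (- w); congr positive; by rewrite stN; ncr.
have h1 := zer m; have := zer ('i%R *: m).
rewrite stZi -scalerAr -scalerAl mulrN mulNr -scalerAr -scalerAl -scalerBr => h2.
have {}h2 : u * m * v - v * cstar m * u = 0.
  by rewrite -[LHS]scale1r -[1]opprK -sqrCi expr2 scaleNr -scalerA h2 scaler0 oppr0.
have h3 : u * m * v + u * m * v = 0.
  rewrite [LHS](_ : _ = (u * m * v + v * cstar m * u) + (u * m * v - v * cstar m * u)).
    by rewrite h1 h2 addr0.
  by ncr.
have := congr1 (fun x => (2^-1 : R)%:C *: x) h3; rewrite scaler0 scalerDr -scalerDl -rmorphD /=.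
by rewrite (_ : 2^-1 + 2^-1 = 1 :> R) ?rmorph1 ?scale1r //; lra.
Qed.

End Comparison.

(** * Commutation from central comparability *)

Section Commutation.
Variables (R : realType) (A : cstarAlg R).
Implicit Types a b c d x y z w r u v f g h m n : A.

Definition centrally_comparable a b :=
  exists f, [/\ cproj f, positive (f * (b - a)) & positive ((1 - f) * (a - b))].

(** Acts as a spectral resolution of y relative to h whose spectral projections are central. *)
Definition comparable_multiples y h :=
  forall t : R, 0 <= t -> t <= 1 -> centrally_comparable y (t%:C *: h).

(** By [sup_orth] a central f separates u = s - (a + y) from v = s - (a + z): u vanishes on f and v
    on 1 - f. Since z - y = u - v, its sign is known on each part. *)
Lemma sup_comparable (AW : AWstar A) (X : set A) a h y z s : order_convex X ->
  X a -> X (a + (h + h + h)) -> positive h ->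
  positive y -> ople y h -> positive z -> ople z h -> is_sup X (a + y) (a + z) s ->
  centrally_comparable y z.
Proof.
move=> cX Xa Xh ph py yh pz zh hs.
have uv m := sup_orth m cX Xa Xh ph py yh pz zh hs.
case: hs => [_ pu pv _].
have [f [cf uf fv]] := central_separation AW uv.
set u := s - (a + y) in uv uf pu; set v := s - (a + z) in uv fv pv.
have fu : f * u = 0 by case: cf => _ ->.
exists (1 - f); split; first exact: cprojC.
  have -> : (1 - f) * (z - y) = u - v - f * u + f * v by rewrite /u /v; ncr.
  by rewrite fu fv subr0 subrK.
have -> : (1 - (1 - f)) * (y - z) = f * v - f * u by rewrite /u /v; ncr.
by rewrite fv fu subr0.
Qed.

(** On f the projection comparing y with th still works; on 1 - f two multiples of h are compared,
    and the sign of t - k decides. *)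
Lemma cut_comparable y h f (k : R) : positive h -> cproj f -> comparable_multiples y h ->
  comparable_multiples (f * y + (1 - f) * (k%:C *: h)) h.
Proof.
move=> ph cf hy t t0 t1; have [g [cg g1 g2]] := hy t t0 t1.
have ff : f * f = f by case: cf => -[].
have fg : f * g = g * f by case: cf => _ ->.
have fgf : f * g * f = f * g by rewrite -mulrA -fg mulrA ff.
have cf' := cprojC cf; have cfg := cprojM cf cg.
have kt : ((t - k)%:C *: h) = t%:C *: h - k%:C *: h by rewrite rmorphB scalerBl.
have [tk|tk] := leP k t.
- exists (f * g + (1 - f)); split.
  + have -> : f * g + (1 - f) = 1 - f * (1 - g) by ncr.
    by apply/cprojC/cprojM => //; apply: cprojC.
  + have -> : (f * g + (1 - f)) * (t%:C *: h - (f * y + (1 - f) * (k%:C *: h)))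
      = f * (g * (t%:C *: h - y)) + (1 - f) * ((t - k)%:C *: h)
        + (f * g - f * g * f) * (y - k%:C *: h) + (f * f - f) * (y - k%:C *: h).
      by rewrite kt; ncr.
    rewrite fgf ?ff !subrr !mul0r !addr0.
    apply: posD; apply: cproj_pos => //.
    by apply: posZ => //; rewrite subr_ge0.
  + have -> : (1 - (f * g + (1 - f))) * (f * y + (1 - f) * (k%:C *: h) - t%:C *: h)
      = f * ((1 - g) * (y - t%:C *: h)) + (f * f - f - (f * g * f - f * g)) * (y - k%:C *: h) by ncr.
    rewrite fgf ?ff !subrr ?subr0 mul0r addr0.
    exact: cproj_pos.
- exists (f * g); split => //.
  + have -> : f * g * (t%:C *: h - (f * y + (1 - f) * (k%:C *: h)))
      = f * (g * (t%:C *: h - y)) + (f * g - f * g * f) * (y - k%:C *: h) by ncr.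
    rewrite fgf ?ff !subrr !mul0r !addr0.
    exact: cproj_pos.
  + have -> : (1 - f * g) * (f * y + (1 - f) * (k%:C *: h) - t%:C *: h)
      = f * ((1 - g) * (y - t%:C *: h)) - (1 - f) * ((t - k)%:C *: h)
        + (f * g - f * g * f) * (y - k%:C *: h) by rewrite kt; ncr.
    rewrite fgf ?ff !subrr !mul0r !addr0.
    apply: posD; first exact: cproj_pos.
    rewrite -mulrN -scaleNr -rmorphN opprB; apply: cproj_pos => //.
    by apply: posZ => //; rewrite subr_ge0 ltW.
Qed.

Lemma cut_l g y z : cproj g -> g * (g * y + (1 - g) * z) = g * y.
Proof.
move=> [[gg _] _]; have -> : g * (g * y + (1 - g) * z) = g * g * (y - z) + g * z by ncr.
by rewrite gg -mulrDr subrK.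
Qed.

(** Each step cuts [al, be] at its midpoint by a central projection and halves the bound. The factor
    i makes the twisted commutator self-adjoint, so that it can be bounded in the operator order on
    each central part separately. *)
Lemma bisection h m (k : nat) : positive h -> selfadj m -> forall y (al be : R),
  0 <= al -> al <= be -> be <= 1 -> selfadj y -> comparable_multiples y h ->
  ople (al%:C *: h) y -> ople y (be%:C *: h) ->
  ople ('i%R *: (y * m * h - h * m * y))
       (2 * nm h * nm m * nm h * (be - al) / 2 ^+ k)%:C%:A.
Proof.
move=> ph sm; have sh := pos_sa ph; elim: k => [|k ih] y al be al0 ab be1 sy hy ya yb.
  (* Multiples of h contribute nothing to ymh - hmy, so only the part of y above al h counts, and
     its norm is at most (be - al) nm h. *)
  pose y0 := y - al%:C *: h.
  have ny0 : nm y0 <= (be - al) * nm h.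
    have := @nm_mono _ _ y0 ((be - al)%:C *: h) ya.
    rewrite nmZr ger0_norm ?subr_ge0 //; apply.
    by rewrite /ople rmorphB scalerBl opprB addrA subrK.
  have -> : y * m * h - h * m * y = y0 * m * h - h * m * y0.
    rewrite /y0 !mulrBl !mulrBr -!scalerAl -!scalerAr; ncr.
  apply: le_nm.
    by rewrite /selfadj stZi stB !stM sh sm /y0 stB stZr sh sy -scalerN opprB !mulrA.
  rewrite nmZi expr0 divr1; apply: le_trans (nmB _ _) _.
  have h1 := nmM (y0 * m) h; have h2 := nmM y0 m.
  have h3 := nmM (h * m) y0; have h4 := nmM h m.
  have e1 : nm (y0 * m * h) <= (be - al) * nm h * nm m * nm h.
    apply: le_trans h1 _; rewrite ler_wpM2r ?nm_ge0 //; apply: le_trans h2 _.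
    by rewrite ler_wpM2r ?nm_ge0.
  have e2 : nm (h * m * y0) <= nm h * nm m * ((be - al) * nm h).
    by apply: le_trans h3 _; rewrite ler_pM ?nm_ge0.
  apply: le_trans (lerD e1 e2) _; rewrite le_eqVlt; apply/orP; left; apply/eqP; ring.
pose mu := (al + be) / 2.
have [a1 a2] : al <= mu /\ mu <= be by rewrite /mu; split; lra.
have [f [cf f1 f2]] := hy mu (le_trans al0 a1) (le_trans a2 be1).
have cf' := cprojC cf; have [[ff sf] fC] := cf.
(* [y1] agrees with y on f and lies between al h and mu h; [y2] agrees with y on 1 - f and lies
   between mu h and be h. The other part is filled with mu h. *)
pose y1 := f * y + (1 - f) * (mu%:C *: h).
pose y2 := (1 - f) * y + (1 - (1 - f)) * (mu%:C *: h).
have sfx g x : cproj g -> selfadj x -> selfadj (g * x).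
  by move=> [[gg sg] cg] sx; rewrite /selfadj stM sx sg cg.
have smu : selfadj (mu%:C *: h) by apply: saZ.
pose D x := 'i%R *: (x * m * h - h * m * x).
have DE g x x' : cproj g -> g * x = g * x' -> g * D x = g * D x'.
  move=> [_ cg] gx.
  have E z : g * D z = 'i%R *: (g * z * m * h - h * m * (g * z)).
    by rewrite -scalerAr mulrBr !mulrA -[h * m * g]cg !mulrA.
  by rewrite !E gx.
set e := 2 * nm h * nm m * nm h * (be - al) / 2 ^+ k.+1.
have e1 : e = 2 * nm h * nm m * nm h * (mu - al) / 2 ^+ k.
  by rewrite /e exprS invfM mulrA; congr (_ / _); rewrite /mu; field.
have e2 : e = 2 * nm h * nm m * nm h * (be - mu) / 2 ^+ k.
  by rewrite /e exprS invfM mulrA; congr (_ / _); rewrite /mu; field.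
have i1 : ople (D y1) e%:C%:A.
  rewrite e1; apply: ih => //; first exact: le_trans be1.
  - by apply: saD; apply: sfx.
  - exact: cut_comparable.
  - have -> : ople (al%:C *: h) y1 =
      positive (f * (y - al%:C *: h) + (1 - f) * ((mu - al)%:C *: h)).
      by congr positive; rewrite rmorphB scalerBl /y1; ncr.
    by apply: posD; apply: cproj_pos => //; apply: posZ => //; rewrite subr_ge0.
  - have -> : ople y1 (mu%:C *: h) = positive (f * (mu%:C *: h - y)) => //.
    by congr positive; rewrite /y1; ncr.
have i2 : ople (D y2) e%:C%:A.
  rewrite e2; apply: ih => //; first exact: le_trans a1.
  - by apply: saD; apply: sfx => //; apply: cprojC.
  - exact: cut_comparable.
  - have -> : ople (mu%:C *: h) y2 = positive ((1 - f) * (y - mu%:C *: h)) => //.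
    by congr positive; rewrite /y2; ncr.
  - have -> : ople y2 (be%:C *: h) =
      positive ((1 - f) * (be%:C *: h - y) + f * ((be - mu)%:C *: h)).
      by congr positive; rewrite rmorphB scalerBl /y2; ncr.
    by apply: posD; apply: cproj_pos => //; apply: posZ => //; rewrite subr_ge0.
apply: (cproj_split cf).
  by have := cproj_pos cf i1; rewrite !mulrBr (DE f y1 y) // cut_l.
by have := cproj_pos cf' i2; rewrite !mulrBr (DE (1 - f) y2 y) // cut_l.
Qed.

(** Letting k grow in [bisection] bounds i(ymh - hmy) above by 0; the same for -m bounds it below.
    Linearity in m removes the restriction to self-adjoint m. *)
Lemma comparable_comm h y m : positive h -> positive y -> ople y h ->
  comparable_multiples y h -> y * m * h = h * m * y.
Proof.
move=> ph py yh hy; have sh := pos_sa ph; have sy := pos_sa py.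
move: m; apply: span_sa => [a b ea eb|k a ea|m sm].
- by rewrite !(mulrDr, mulrDl) ea eb.
- by rewrite -!(scalerAl, scalerAr) ea.
have neg n : selfadj n -> positive (- ('i%R *: (y * n * h - h * n * y))).
  move=> sn; apply: pos_eps => e e0.
  pose C := 2 * nm h * nm n * nm h.
  have C0 : 0 <= C by rewrite !mulr_ge0 ?nm_ge0.
  pose k := Num.bound (C / e).
  have hk : C / 2 ^+ k <= e.
    have h1 : C / e < k%:R by apply: archi_boundP; rewrite divr_ge0 // ltW.
    have h2 : (k%:R : R) <= 2 ^+ k by rewrite -natrX ler_nat ltnW // ltn_expl.
    rewrite ler_pdivrMr ?exprn_gt0 // mulrC -ler_pdivrMr //.
    exact: ltW (lt_le_trans h1 h2).
  have := @bisection h n k ph sn y 0 1 (lexx 0) ler01 (lexx 1) sy hy.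
  rewrite subr0 mulr1 scale0r scale1r /ople subr0 -/C => /(_ py yh) h1.
  rewrite -(subrK (C / 2 ^+ k)%:C%:A (e%:C%:A)) -addrA.
  apply: posD => //; rewrite -scalerBl -rmorphB; apply: pos_alg.
  by rewrite subr_ge0.
have h1 := neg m sm; have h2 := neg (- m) (saN sm).
have : 'i%R *: (y * m * h - h * m * y) = 0.
  rewrite -[LHS]opprK; apply/eqP; rewrite oppr_eq0; apply/eqP; apply: pos_anti => //.
  have -> : - ('i%R *: (y * m * h - h * m * y)) = 'i%R *: (y * - m * h - h * - m * y).
    by rewrite -scalerN !(mulrN, mulNr) opprB opprK addrC.
  exact: h2.
move=> /eqP; rewrite scaler_eq0 (negbTE (neq0Ci _)) subr_eq0 => /eqP.
by [].
Qed.

End Commutation.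

(** * The order-theoretic description of the commutative part *)

Section Abelian.
Variables (R : realType) (A : cstarAlg R).
Implicit Types a b c d x y z w r u v f g h m n p : A.

(** Replacing m by mg^-1 turns the hypothesis into ym = gmg^-1y, and g commutes with y by the case m
    = 1. *)
Lemma central_quotient y g m : g \is a GRing.unit ->
  (forall m, y * m * g = g * m * y) -> (y * g^-1) * m = m * (y * g^-1).
Proof.
move=> ug yg.
have yg1 : y * g = g * y by have := yg 1; rewrite !mulr1.
have gy : y * g^-1 = g^-1 * y by apply: commrV.
have := yg (m * g^-1); rewrite !mulrA mulrVK // => h.
by rewrite {1}gy -(mulrA g^-1) h -!mulrA mulKr // -gy.
Qed.

(* The elements of [0, x] are multiples of g by central elements, so xg^-1 absorbs
   all commutators. *)
Lemma abelian_part (AW : AWstar A) p x g (e : R) : is_pA1 p -> positive x -> 0 < e ->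
  selfadj g -> ople e%:C%:A g ->
  (forall y m, positive y -> ople y x -> y * m * g = g * m * y) -> (1 - p) * x = 0.
Proof.
move=> [pp cp comp maxp] px e0 sg ge hx.
have pg : positive g by rewrite -(subrK e%:C%:A g); apply: posD => //; apply: pos_alg; exact: ltW.
have ug : g \is a GRing.unit.
  by have [_] : oplt 0 g; [apply: (eps_oplt e0); rewrite add0r | rewrite subr0].
have hxx := fun m => hx x m px (ople_refl x).
pose k := x * g^-1.
have kc m : k * m = m * k by apply: central_quotient.
have gk : x = k * g by rewrite /k mulrVK.
have pV : positive g^-1.
  by have := pos_conj g^-1 pg; rewrite (saV sg) mulVr // mul1r.
have pk : positive k.
  have [r [pr r2 rc]] := pos_sqrt px.
  have rg : r * g = g * r by apply: rc; have := hxx 1; rewrite !mulr1.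
  have rV : r * g^-1 = g^-1 * r by apply: commrV.
  have := pos_conj r pV; rewrite (pos_sa pr) -mulrA -rV mulrA r2.
  by [].
have [r [pr r2 rc]] := pos_sqrt pk; have sr := pos_sa pr.
have rcc m : r * m = m * r by apply: rc; exact: kc.
have pkm m : positive m -> positive (k * m).
  by move=> /(pos_conj r); rewrite sr -mulrA -rcc mulrA r2.
(* Here x = kg with g >= e, and multiplication by the positive central k preserves positivity. *)
have ek : ople (e%:C *: k) x.
  rewrite /ople gk -[e%:C *: k]mulr_algr -mulrBr; exact: pkm.
(* For n in [0, 1] the element e k n lies in [0, x], where the hypothesis applies; such n span the
   algebra. *)
have Q n : forall m, (k * n) * m * g = g * m * (k * n).
  move: n; apply: span_unit_interval => [a b ha hb m|l a ha m|n pn n1 m].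
  - by rewrite !(mulrDr, mulrDl) ha hb.
  - by rewrite -!(scalerAl, scalerAr) ha.
  have h1 : positive (e%:C *: (k * n)) by apply: posZ; [exact: ltW|exact: pkm].
  have h2 : ople (e%:C *: (k * n)) x.
    apply: ople_trans ek; rewrite /ople -scalerBr -[X in X - _]mulr1 -mulrBr.
    by apply: posZ; [exact: ltW|exact: pkm].
  have := hx _ m h1 h2; rewrite -!(scalerAl, scalerAr) => /(congr1 (fun x => e^-1%:C *: x)).
  by rewrite !scalerA -rmorphM /= mulVf ?gt_eqF // rmorph1 !scale1r.
have kn n m : k * (n * m - m * n) = 0.
  have h : k * n * m = m * (k * n).
    by have := central_quotient m ug (Q (n * g)); rewrite mulrA mulrK.
  by rewrite mulrBr !mulrA h [k * m]kc mulrA subrr.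
pose F : set A := [set b | exists n m w, b = (n * m - m * n) * w].
have [|b w [n [m [w' ->]]]|f [cf f0 fk]] := @annihilator _ _ AW F.
- by exists 0, 0, 0, 0; rewrite mulr0.
- by exists n, m, (w' * w); rewrite mulrA.
have fC z : f * z = z * f by case: cf => _ ->.
have fn n m : (n * m - m * n) * f = 0.
  by apply: f0; exists n, m, 1; rewrite mulr1.
have fkk : f * k = k.
  by apply: fk => _ [n [m [w ->]]]; rewrite -mulrA -kc mulrA -kc kn mul0r.
have cq : cproj (1 - p) by apply: cprojC.
have cz := cprojM cf cq; have [[zz sz] zc] := cz.
(* f annihilates all commutators, so f(1 - p) is a central projection below 1 - p with commutative
   corner; maximality of p kills it. *)
have zcomm : f * (1 - p) = 0.
  apply: maxp => //.
    have c1 := cprojM (cprojC cf) cq; have [[h1 h2] _] := c1.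
    rewrite /ople; have -> : 1 - p - f * (1 - p) = (1 - f) * (1 - p) by ncr.
    by rewrite -h1; apply: pos_sq.
  move=> a b; set z := f * (1 - p) in zz zc *.
  have E a' b' : z * a' * (z * b') = z * (a' * b').
    by rewrite mulrA -[z * a' * z]mulrA -zc mulrA zz -mulrA.
  apply/eqP; rewrite !E -subr_eq0 -mulrBr; apply/eqP.
  by rewrite /z fC -mulrA fC fn mulr0.
by rewrite gk mulrA -fkk mulrA -fC zcomm !mul0r.
Qed.

End Abelian.

(** * Suprema and infima in interval-like sets *)

Section Lattice.
Variables (R : realType) (A : cstarAlg R).
Implicit Types a b c d l s t x y z w u v f g h k m n p : A.

Lemma comparable_of_commutative_corner (AW : AWstar A) p b c : cproj p -> commutative_corner p ->
  selfadj b -> selfadj c -> positive ((1 - p) * (c - b)) -> centrally_comparable b c.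
Proof.
move=> cp comp sb sc pq; have [[pp sp] pC] := cp.
have [u [v [pu pv E [uv _]]]] := pos_part (saB sb sc).
have pup z : p * z * p = p * z by rewrite -mulrA -pC mulrA pp.
have h m : p * u * m * (p * v) = 0.
  have -> : p * u * m = p * u * (p * m) by rewrite [RHS]mulrA pup.
  by rewrite comp -mulrA [p * u * (p * v)]mulrA pup -[p * u * v]mulrA uv !mulr0.
have [f [cf uf fv]] := central_separation AW h.
have fC z : f * z = z * f by case: cf => _ ->.
(* u and v are the positive and negative parts of b - c. On pf the part u vanishes and b <= c; on
   p(1 - f) the part v vanishes and c <= b; on 1 - p the hypothesis gives b <= c. *)
exists (1 - p * (1 - f)); split.
- by apply/cprojC/cprojM => //; apply: cprojC.
- have -> : (1 - p * (1 - f)) * (c - b) = (1 - p) * (c - b) + p * (f * (- (b - c))) by ncr.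
  rewrite E; apply: posD => //.
  have -> : p * (f * - (u - v)) = f * (p * v) - p * u * f.
    by rewrite -(fC (p * u)) opprB !mulrBr !mulrA -(fC p).
  by rewrite fv uf subr0; apply: cproj_pos.
- have -> : (1 - (1 - p * (1 - f))) * (b - c) = p * (b - c) - p * (f * (b - c)) by ncr.
  have -> : p * (b - c) - p * (f * (b - c)) = p * u - p * u * f + f * (p * v) - p * v.
    by rewrite E -(fC (p * u)) !mulrBr !mulrA -(fC p); ncr.
  by rewrite uf fv subr0 addrK; apply: cproj_pos.
Qed.

Lemma comparable_sym b c : centrally_comparable b c -> centrally_comparable c b.
Proof.
move=> [f [cf h1 h2]]; exists (1 - f); split=> //; first exact: cprojC.
by rewrite (_ : 1 - (1 - f) = f) //; ncr.
Qed.

Definition is_inf (X : set A) b c s :=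
  [/\ X s, ople s b, ople s c & forall t, X t -> ople t b -> ople t c -> ople t s].

Lemma inf_opp (X : set A) b c s :
  is_inf X b c s -> is_sup [set d | X (- d)] (- b) (- c) (- s).
Proof.
have N x y : ople x y -> ople (- y) (- x) by rewrite /ople opprK addrC.
move=> [Xs sb sc h]; split; rewrite /= ?opprK //; try exact: N.
move=> t Xt bt ct; rewrite -[t]opprK; apply: (N).
by apply: h => //; [rewrite -[b]opprK|rewrite -[c]opprK]; apply: (N).
Qed.

Definition central_mixing (X : set A) :=
  forall f a b, cproj f -> X a -> X b -> X (f * a + (1 - f) * b).

Lemma comparable_sup (X : set A) b c : central_mixing X -> X b -> X c ->
  centrally_comparable b c -> exists s, is_sup X b c s.
Proof.
move=> mX Xb Xc [f [cf h1 h2]]; exists (f * c + (1 - f) * b); split.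
- exact: mX.
- by rewrite /ople (_ : _ - _ = f * (c - b)) //; ncr.
- by rewrite /ople (_ : _ - _ = (1 - f) * (b - c)) //; ncr.
- move=> t Xt bt ct.
  rewrite /ople (_ : _ - _ = f * (t - c) + (1 - f) * (t - b)); last by ncr.
  by apply: posD; apply: cproj_pos => //; apply: cprojC.
Qed.

Lemma comparable_inf (X : set A) b c : central_mixing X -> X b -> X c ->
  centrally_comparable b c -> exists s, is_inf X b c s.
Proof.
move=> mX Xb Xc [f [cf h1 h2]]; exists (f * b + (1 - f) * c); split.
- exact: mX.
- by rewrite /ople (_ : _ - _ = (1 - f) * (b - c)) //; ncr.
- by rewrite /ople (_ : _ - _ = f * (c - b)) //; ncr.
- move=> t Xt bt ct.
  rewrite /ople (_ : _ - _ = f * (b - t) + (1 - f) * (c - t)); last by ncr.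
  by apply: posD; apply: cproj_pos => //; apply: cprojC.
Qed.

(** The common properties of all operator intervals that the argument relies on. The final pair with
    a uniform gap provides the invertible element in [lattice_pairP]. *)
Definition interval_like (X : set A) :=
  [/\ forall a, X a -> selfadj a, order_convex X, central_mixing X,
      (forall a b, X a -> X b -> exists c, [/\ X c, ople a c & ople b c]) &
      (forall a b, X a -> X b -> exists c, [/\ X c, ople c a & ople c b])] /\
  exists l u (e : R), [/\ X l, X u, 0 < e & ople (l + e%:C%:A) u].

(** Only c is confined to [a, b]; d is bounded on one side, so that it can run through multiples of
    the whole room left in X. *)
Definition lattice_pair (X : set A) a b :=
  forall c d, X c -> X d -> ople a c -> ople c b ->
    (ople a d -> exists s, is_sup X c d s) /\ (ople d b -> exists s, is_inf X c d s).

Lemma sup_comm (AW : AWstar A) (X : set A) a h x : order_convex X ->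
  X a -> X (a + (h + h + h)) -> positive x -> ople x h ->
  (forall y z, positive y -> ople y x -> positive z -> X (a + z) ->
     exists s, is_sup X (a + y) (a + z) s) ->
  forall y m, positive y -> ople y x -> y * m * h = h * m * y.
Proof.
move=> cX Xa Xh px xh hs y m py yx.
have ph : positive h by rewrite -(subrK x h); apply: posD.
have yh := ople_trans yx xh.
apply: comparable_comm => // t t0 t1.
have pt : positive (t%:C *: h) by apply: posZ.
have th : ople (t%:C *: h) h.
  have -> : ople (t%:C *: h) h = positive ((1 - t)%:C *: h).
    by rewrite rmorphB scalerBl rmorph1 scale1r.
  by apply: posZ; rewrite ?subr_ge0.
have Xt : X (a + t%:C *: h).
  apply: (cX _ _ _ Xa Xh); first by rewrite /ople addrC addKr.
  rewrite /ople (_ : _ - _ = (h - t%:C *: h) + h + h); last by ncr.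
  by apply: posD => //; apply: posD.
have [s hss] := hs y _ py yx pt Xt.
exact: (sup_comparable AW cX Xa Xh ph py yh pt th hss).
Qed.

Lemma third3 a : let t := (3^-1 : R)%:C *: a in t + t + t = a.
Proof.
move=> t; rewrite /t -!scalerDl -!rmorphD /= (_ : _ + _ = 1) ?rmorph1 ?scale1r //.
by field.
Qed.

Lemma lattice_pairP (AW : AWstar A) p (X : set A) a b : is_pA1 p -> interval_like X ->
  X a -> X b -> ople a b -> lattice_pair X a b <-> (1 - p) * a = (1 - p) * b.
Proof.
move=> hp [[sX cX mX uX dX] [l0 [u0 [e [Xl0 Xu0 e0 lu]]]]] Xa Xb ab.
have [pp cp comp _] := hp.
have cP : cproj p by []. have cq := cprojC cP.
split=> [H|qab]; last first.
  move=> c d Xc Xd ac cb.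
  (* Elements of [a, b] agree on 1 - p, since (1 - p)(y - a) lies between 0 and (1 - p)(b - a) =
     0. *)
  have q0 z z' : ople a z -> ople z b -> ople a z' -> ople z' b -> (1 - p) * (z - z') = 0.
  - move=> az zb az' zb'.
    have E y : ople a y -> ople y b -> (1 - p) * (y - a) = 0.
    - move=> ay yb; apply: pos_anti; first exact: cproj_pos.
      rewrite -mulrN opprB mulrBr qab -mulrBr; exact: cproj_pos.
    have -> : (1 - p) * (z - z') = (1 - p) * (z - a) - (1 - p) * (z' - a) by ncr.
    by rewrite !E // subr0.
  have haa := ople_refl a; have hbb := ople_refl b.
  split=> hd.
  - apply: comparable_sup => //; apply: (@comparable_of_commutative_corner AW p); auto.
    have -> : (1 - p) * (d - c) = (1 - p) * (d - a) - (1 - p) * (c - a) by ncr.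
    by rewrite (q0 c a) // subr0; apply: cproj_pos.
  - apply: comparable_inf => //; apply: comparable_sym.
    apply: (@comparable_of_commutative_corner AW p); auto.
    have -> : (1 - p) * (c - d) = (1 - p) * (b - d) - (1 - p) * (b - c) by ncr.
    by rewrite (q0 b c) // subr0; apply: cproj_pos.
(* Enlarging to u above u0 and l below l0 keeps the gap: u - l >= u0 - l0 >= e. *)
have [u [Xu bu u0u]] := uX _ _ Xb Xu0.
have [l [Xl la ll0]] := dX _ _ Xa Xl0.
pose th : R[i] := (3^-1 : R)%:C.
have th0 : (0 : R) <= 3^-1 by rewrite invr_ge0.
(* Thirds, because [sup_comm] asks for room h + h + h above a. *)
pose x := th *: (b - a); pose h := th *: (u - a); pose k := th *: (b - l).
have px : positive x by apply: posZ.
have xh : ople x h.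
  rewrite /ople -scalerBr; apply: posZ => //.
  by rewrite (_ : _ - _ = u - b) //; ncr.
have xk : ople x k.
  rewrite /ople -scalerBr; apply: posZ => //.
  by rewrite (_ : _ - _ = a - l) //; ncr.
have x3 y : ople y x -> positive y -> ople y (b - a).
  move=> yx py; rewrite -(third3 (b - a)) /= -/th -/x.
  rewrite /ople (_ : _ - _ = (x - y) + x + x); last by ncr.
  by apply: posD => //; apply: posD.
have C1 y m : positive y -> ople y x -> y * m * h = h * m * y.
  apply: (sup_comm AW cX Xa _ px xh); first by rewrite third3 addrC subrK.
  move=> {}y z py yx pz Xz.
  have ay : ople a (a + y) by rewrite /ople addrC addKr.
  have yb : ople (a + y) b by have := x3 y yx py; rewrite /ople opprD addrA.
  have Xy : X (a + y) by apply: (cX _ _ _ Xa Xb).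
  have [hi _] := H _ _ Xy Xz ay yb.
  by apply: hi; rewrite /ople addrC addKr.
(* The infimum half of the condition, read through the order reversal c -> -c. *)
have C2 y m : positive y -> ople y x -> y * m * k = k * m * y.
  apply: (@sup_comm AW [set d | X (- d)] (- b) k x) => //=.
  - move=> c d f Xc Xd cf fd.
    by apply: (cX _ _ _ Xd Xc); rewrite /ople opprK addrC.
  - by rewrite opprK.
  - by rewrite third3 (_ : - (- b + (b - l)) = l) //; ncr.
  move=> {}y z py yx pz; rewrite opprD opprK => Xz.
  have yb : ople (b - y) b by rewrite /ople subKr.
  have ay : ople a (b - y) by have := x3 y yx py; rewrite /ople addrAC.
  have Xy : X (b - y) by apply: (cX _ _ _ Xa Xb).
  have [_ hi] := H _ _ Xy Xz ay yb.
  have [|s hs] := hi; first by rewrite /ople subKr.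
  by exists (- s); have := inf_opp hs; rewrite !opprB ![_ - b]addrC.
have qx : (1 - p) * x = 0.
  (* h + k is a third of (u - l) + (b - a), hence at least e/3. *)
  apply: (@abelian_part _ _ AW p x (h + k) (3^-1 * e)) => //.
  - by rewrite mulr_gt0 ?invr_gt0.
  - by apply: saD; apply: saZ; apply: saB; auto.
  - rewrite /ople /h /k -scalerDr rmorphM -scalerA -scalerBr; apply: posZ => //.
    rewrite (_ : _ - _ = (u - u0) + (u0 - (l0 + e%:C%:A)) + (l0 - l) + (b - a)); last by ncr.
    by apply: posD => //; apply: posD => //; apply: posD.
  - by move=> y m py yx; rewrite mulrDr !mulrDl C1 // C2.
apply/eqP; rewrite eq_sym -subr_eq0 -mulrBr -(third3 (b - a)) /= -/th -/x.
by rewrite !mulrDr qx !addr0.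
Qed.

End Lattice.

(** * Operator intervals *)

Section Intervals.
Variables (R : realType) (A : cstarAlg R).
Implicit Types a b c d l u f : A.

(** A one-sided constraint, imposed on c for the lower end and on -c for the upper end; three kinds
    of end then cover all nine shapes of interval. *)
Definition lower_bound_like (L : set A) :=
  [/\ forall c d, L c -> ople c d -> L d,
      forall f c d, cproj f -> L c -> L d -> L (f * c + (1 - f) * d) &
      forall c d, selfadj c -> selfadj d -> L c -> L d ->
        exists b, [/\ L b, ople b c & ople b d]].

Lemma lower_all : lower_bound_like setT.
Proof.
split=> // c d sc sd _ _.
have pN x : selfadj x -> positive ((nm x)%:C%:A + x).
  by move=> sx; rewrite -[x in _ + x]opprK; apply: le_nm; [exact: saN | rewrite nmN].
have p0 x : positive ((nm x)%:C%:A : A) by apply: pos_alg; exact: nm_ge0.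
exists (- ((nm c)%:C%:A + (nm d)%:C%:A)); split=> //; rewrite /ople opprK addrC.
  by rewrite addrAC; apply: posD => //; exact: pN.
by rewrite -addrA; apply: posD => //; exact: pN.
Qed.

Lemma ople_mix f a c d : cproj f -> ople a c -> ople a d -> ople a (f * c + (1 - f) * d).
Proof.
move=> cf ac ad; rewrite /ople (_ : _ - _ = f * (c - a) + (1 - f) * (d - a)); last by ncr.
by apply: posD; apply: cproj_pos => //; apply: cprojC.
Qed.

Lemma lower_ge a : lower_bound_like [set c | ople a c].
Proof.
split=> [c d|f c d|c d sc sd ac ad]; [exact: ople_trans|exact: ople_mix|].
by exists a; split=> //; exact: ople_refl.
Qed.

Lemma common_eps a c d : oplt a c -> oplt a d ->
  exists e : R, [/\ 0 < e, ople (a + e%:C%:A) c & ople (a + e%:C%:A) d].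
Proof.
move=> /oplt_eps[e1 e10 h1] /oplt_eps[e2 e20 h2].
have le (k k' : R) : k <= k' -> ople (a + k%:C%:A) (a + k'%:C%:A).
  by move=> kk; rewrite /ople addKBl -scalerBl -rmorphB; apply: pos_alg; rewrite subr_ge0.
exists (Num.min e1 e2); split; first by rewrite lt_min e10.
  by apply: ople_trans h1; apply: le; rewrite ge_min lexx.
by apply: ople_trans h2; apply: le; rewrite ge_min lexx orbT.
Qed.

Lemma lower_gt a : lower_bound_like [set c | oplt a c].
Proof.
split=> /= [c d /oplt_eps[e e0 h] cd|f c d cf ac ad|c d sc sd ac ad].
- by apply: (eps_oplt e0); apply: ople_trans cd.
- by have [e [e0 h1 h2]] := common_eps ac ad; apply: (eps_oplt e0); apply: ople_mix.
- have [e [e0 h1 h2]] := common_eps ac ad.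
  by exists (a + e%:C%:A); split=> //; apply: (eps_oplt e0); exact: ople_refl.
Qed.

Lemma ople_opp a b : ople a b -> ople (- b) (- a).
Proof. by rewrite /ople opprK addrC. Qed.

Lemma oplt_opp a b : oplt a b -> oplt (- b) (- a).
Proof. by rewrite /oplt opprK addrC. Qed.

Lemma interval_likeI (L U X : set A) : lower_bound_like L -> lower_bound_like U ->
  (forall c, X c <-> [/\ selfadj c, L c & U (- c)]) ->
  (exists l u (e : R), [/\ X l, X u, 0 < e & ople (l + e%:C%:A) u]) ->
  interval_like X.
Proof.
move=> [Lu Lm Ld] [Uu Um Ud] XE lu; split => //.
have le_sa a b : selfadj a -> ople a b -> selfadj b.
  by move=> sa ab; rewrite -(subrK a b); apply: saD => //; exact: pos_sa.
have le_sa' a b : selfadj b -> ople a b -> selfadj a.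
  by move=> sb ab; rewrite -(subKr b a); apply: saB => //; exact: pos_sa.
split.
- by move=> a /XE[].
- move=> a b c /XE[sa la ua] /XE[sb lb ub] ac cb; apply/XE; split.
  + exact: le_sa ac.
  + exact: Lu ac.
  + by apply: Uu ub _; exact: ople_opp.
- move=> f a b cf /XE[sa la ua] /XE[sb lb ub]; apply/XE; split.
  + have [[_ sf] fC] := cf; rewrite /selfadj stD !stM stB st1 sf sa sb fC.
    by rewrite mulrBr mulrBl fC mul1r mulr1.
  + exact: Lm.
  + by rewrite opprD -!mulrN; exact: Um.
- move=> a b /XE[sa la ua] /XE[sb lb ub].
  have [c [uc ca cb]] := Ud _ _ (saN sa) (saN sb) ua ub.
  have ac : ople a (- c) by rewrite -[a]opprK; exact: ople_opp.
  have bc : ople b (- c) by rewrite -[b]opprK; exact: ople_opp.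
  exists (- c); split=> //; apply/XE; split; rewrite ?opprK //.
    exact: le_sa ac.
  exact: Lu ac.
- move=> a b /XE[sa la ua] /XE[sb lb ub].
  have [c [lc ca cb]] := Ld _ _ sa sb la lb.
  exists c; split=> //; apply/XE; split=> //; first exact: le_sa' ca.
  by apply: Uu ua _; exact: ople_opp.
Qed.

Lemma opint_interval_like (I : opint A) : opint_valid I -> interval_like (opint_set I).
Proof.
have oN a b : oplt (- a) (- b) <-> oplt b a.
  by split=> /oplt_opp; rewrite ?opprK.
have pN a b : ople (- a) (- b) <-> ople b a.
  by split=> /ople_opp; rewrite ?opprK.
have p1 : positive (1 : A) by have := pos_alg A (@ler01 R); rewrite rmorph1 scale1r.
have lt1 a : oplt a (a + 1).
  by apply: (@eps_oplt _ _ _ _ 1) => //; rewrite rmorph1 scale1r; exact: ople_refl.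
(* Divide the gap between a and b into three equal steps k and take l = a + k, u = a + 2k. *)
have two a b : oplt a b -> exists l u (e : R),
    [/\ oplt a l, oplt a u, oplt l b & oplt u b] /\ (0 < e /\ ople (l + e%:C%:A) u).
  move=> /oplt_eps[e e0 h]; pose k := e / 3; have k0 : 0 < k by rewrite /k; lra.
  have ek : e = k + k + k by rewrite /k; field.
  have pk : positive (k%:C%:A : A) by apply: pos_alg; exact: ltW.
  have h2 : ople (a + k%:C%:A + k%:C%:A + k%:C%:A) b.
    by move: h; rewrite ek !rmorphD !scalerDl !addrA.
  have s c : ople c (c + k%:C%:A) by rewrite /ople addrC addKr.
  exists (a + k%:C%:A), (a + k%:C%:A + k%:C%:A), k.
  split; last by split=> //; exact: ople_refl.
  split; apply: (eps_oplt k0) => //; first exact: ople_refl.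
  exact: ople_trans h2.
have lt_sa a b : selfadj a -> oplt a b -> selfadj b.
  by move=> sa [pab _]; rewrite -(subrK a b); apply: saD => //; exact: pos_sa.
have le a b : oplt a b -> ople a b by case.
have one_up a : selfadj a -> exists l u (e : R),
    [/\ selfadj l, selfadj u, oplt a l & oplt a u] /\ (0 < e /\ ople (l + e%:C%:A) u).
  move=> sa; have [l [u [e [[h1 h2 _ _] h]]]] := two a _ (lt1 a).
  exists l, u, e; split=> //; split=> //; exact: lt_sa h1 || exact: lt_sa h2.
have one_down a : selfadj a -> exists l u (e : R),
    [/\ selfadj l, selfadj u, oplt l a & oplt u a] /\ (0 < e /\ ople (l + e%:C%:A) u).
  move=> sa; have hh : oplt (a - 1) a by have := lt1 (a - 1); rewrite subrK.
  have [l [u [e [[h1 h2 h3 h4] h]]]] := two _ _ hh.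
  have s1 : selfadj (a - 1) by apply: saB => //; exact: sa1.
  exists l, u, e; split=> //; split=> //; [exact: lt_sa h1 | exact: lt_sa h2].
case: I => [|a|a|a|a|a b|a b|a b|a b] /= hI.
- apply: (interval_likeI lower_all lower_all) => [c|]; first by split=> [|[]].
  have [l [u [e [[h1 h2 _ _] [h3 h4]]]]] := one_up 0 (sa0 A).
  by exists l, u, e.
- apply: (interval_likeI (lower_ge a) lower_all) => [c|]; first by split=> [[]|[]].
  have [l [u [e [[h1 h2 /le h5 /le h6] [h3 h4]]]]] := one_up _ hI.
  by exists l, u, e.
- apply: (interval_likeI lower_all (lower_ge (- a))) => [c|].
    by split=> [[? ?]|[? _ ?]]; split=> //; apply/pN.
  have [l [u [e [[h1 h2 /le h5 /le h6] [h3 h4]]]]] := one_down _ hI.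
  by exists l, u, e.
- apply: (interval_likeI (lower_gt a) lower_all) => [c|]; first by split=> [[]|[]].
  have [l [u [e [[h1 h2 h5 h6] [h3 h4]]]]] := one_up _ hI.
  by exists l, u, e.
- apply: (interval_likeI lower_all (lower_gt (- a))) => [c|].
    by split=> [[? ?]|[? _ ?]]; split=> //; apply/oN.
  have [l [u [e [[h1 h2 h5 h6] [h3 h4]]]]] := one_down _ hI.
  by exists l, u, e.
all: have [sa sb ab] := hI; have [l [u [e [[al au lb ub] [h3 h4]]]]] := two _ _ ab.
all: have sl := lt_sa _ _ sa al; have su := lt_sa _ _ sa au.
- apply: (interval_likeI (lower_ge a) (lower_ge (- b))) => [c|].
    by split=> [[? ? ?]|[? ? ?]]; split=> //; apply/pN.
  by exists l, u, e; split=> //; split=> //; apply: le.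
- apply: (interval_likeI (lower_ge a) (lower_gt (- b))) => [c|].
    by split=> [[? ? ?]|[? ? ?]]; split=> //; apply/oN.
  by exists l, u, e; split=> //; split=> //; apply: le.
- apply: (interval_likeI (lower_gt a) (lower_ge (- b))) => [c|].
    by split=> [[? ? ?]|[? ? ?]]; split=> //; apply/pN.
  by exists l, u, e; split=> //; split=> //; apply: le.
- apply: (interval_likeI (lower_gt a) (lower_gt (- b))) => [c|].
    by split=> [[? ? ?]|[? ? ?]]; split=> //; apply/oN.
  by exists l, u, e.
Qed.

End Intervals.

(** * Transport along order isomorphisms and the induced maps on central summands *)

Section Transfer.
Variables (R : realType).
Implicit Types A B : cstarAlg R.

Lemma order_iso_inv A B (X : set A) (Y : set B) Phi : order_iso X Y Phi ->
  exists2 Psi, order_iso Y X Psi & forall y, Y y -> Phi (Psi y) = y.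
Proof.
move=> [f1 f2 f3 f4].
have [Psi h] : {Psi : B -> A & forall y, Y y -> X (Psi y) /\ Phi (Psi y) = y}.
  apply: (@choice _ _ (fun y x => Y y -> X x /\ Phi x = y)) => y; have [Yy|nY] := pselect (Y y); last by exists 0.
  by have [x Xx xy] := f3 y Yy; exists x.
exists Psi => [|y /h[]//]; split.
- by move=> y /h[].
- by move=> x y /h[_ {2}<-] /h[_ {2}<-] ->.
- by move=> x Xx; have [h1 h2] := h _ (f1 _ Xx); exists (Phi x); [exact: f1|exact: f2].
- move=> x y /h[X1 E1] /h[X2 E2]; have := f4 _ _ X1 X2; rewrite E1 E2.
  by move=> [? ?]; split.
Qed.

Lemma sup_transfer A B (X : set A) (Y : set B) Phi b c s : order_iso X Y Phi ->
  X b -> X c -> is_sup X b c s -> is_sup Y (Phi b) (Phi c) (Phi s).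
Proof.
move=> [f1 f2 f3 f4] Xb Xc [Xs bs cs h]; split; [exact: f1|exact/f4|exact/f4|].
by move=> _ /f3[t Xt <-] /f4 bt /f4 ct; apply/f4 => //; apply: h; auto.
Qed.

Lemma inf_transfer A B (X : set A) (Y : set B) Phi b c s : order_iso X Y Phi ->
  X b -> X c -> is_inf X b c s -> is_inf Y (Phi b) (Phi c) (Phi s).
Proof.
move=> [f1 f2 f3 f4] Xb Xc [Xs bs cs h]; split; [exact: f1|exact/f4|exact/f4|].
by move=> _ /f3[t Xt <-] /f4 bt /f4 ct; apply/f4 => //; apply: h; auto.
Qed.

Lemma lattice_pair_transfer A B (X : set A) (Y : set B) Phi a b : order_iso X Y Phi ->
  X a -> X b -> lattice_pair X a b -> lattice_pair Y (Phi a) (Phi b).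
Proof.
move=> hf Xa Xb h; have [f1 f2 f3 f4] := hf.
move=> _ _ /f3[c Xc <-] /f3[d Xd <-] /f4 ac /f4 cb.
have [h1 h2] := h _ _ Xc Xd (ac Xa Xc) (cb Xc Xb); split=> /f4.
  by move=> /(_ Xa Xd)/h1[s hs]; exists (Phi s); apply: (sup_transfer hf).
by move=> /(_ Xd Xb)/h2[s hs]; exists (Phi s); apply: (inf_transfer hf).
Qed.

(** [lattice_pairP] settles the case a <= b. In general, a and b are both compared with d, which
    equals an upper bound c of the two on pA and their common value on 1 - pA. *)
Lemma noncommutative_part_transfer A B (AWA : AWstar A) (AWB : AWstar B) pA pB
  (X : set A) (Y : set B) Phi a b :
  is_pA1 pA -> is_pA1 pB -> interval_like X -> interval_like Y -> order_iso X Y Phi ->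
  X a -> X b -> (1 - pA) * a = (1 - pA) * b -> (1 - pB) * Phi a = (1 - pB) * Phi b.
Proof.
move=> hA hB iX iY hf Xa Xb qab.
have [f1 f2 f3 f4] := hf; have [[_ _ mX uX _] _] := iX.
have up c d : X c -> X d -> (1 - pA) * c = (1 - pA) * d -> ople c d ->
    (1 - pB) * Phi c = (1 - pB) * Phi d.
  move=> Xc Xd qcd cd; have pcd : ople (Phi c) (Phi d) by apply/f4.
  apply/(lattice_pairP AWB hB iY (f1 _ Xc) (f1 _ Xd) pcd).
  by apply: (lattice_pair_transfer hf Xc Xd); apply/(lattice_pairP AWA hA iX Xc Xd cd).
have [pp cp _ _] := hA; have cP : cproj pA by []; have [pp1 _] := pp.
have [c [Xc ac bc]] := uX _ _ Xa Xb.
pose d := pA * c + (1 - pA) * a; have Xd : X d by apply: mX.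
have qd : (1 - pA) * a = (1 - pA) * d.
  have -> : (1 - pA) * d = (pA - pA * pA) * (c - a - a) + (1 - pA) * a
    - (pA - pA * pA) * (- a) by rewrite /d; ncr.
  by rewrite pp1 subrr !mul0r add0r subr0.
have ad : ople a d.
  by rewrite /ople (_ : d - a = pA * (c - a)); [exact: cproj_pos|rewrite /d; ncr].
have bd : ople b d.
  by rewrite /ople /d qab (_ : _ - b = pA * (c - b)); [exact: cproj_pos|ncr].
by rewrite (up a d) // (up b d) // -qab.
Qed.

Lemma mix_proj A p (a b : A) : cproj p ->
  p * (p * a + (1 - p) * b) = p * a /\ (1 - p) * (p * a + (1 - p) * b) = (1 - p) * b.
Proof.
move=> cp; split; first exact: cut_l.
have := cut_l b a (cprojC cp); rewrite (_ : 1 - (1 - p) = p); last by ncr.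
by rewrite [_ * b + _]addrC.
Qed.

Lemma proj_eq A p (a b : A) : p * a = p * b -> (1 - p) * a = (1 - p) * b -> a = b.
Proof. by move=> h1 h2; rewrite -(mul1r a) -(mul1r b) -(subrK p 1) mulrDl [RHS]mulrDl h1 h2. Qed.

Lemma ople_proj A p (a b : A) : cproj p -> ople a b -> ople (p * a) (p * b).
Proof. by move=> cp ab; rewrite /ople -mulrBr; exact: cproj_pos. Qed.

(* pA a = pA b means that [a, b] contains no nontrivial pair agreeing on 1 - pA. *)
Lemma commutative_part_transfer A B (AWA : AWstar A) (AWB : AWstar B) pA pB
  (X : set A) (Y : set B) Phi a b :
  is_pA1 pA -> is_pA1 pB -> interval_like X -> interval_like Y -> order_iso X Y Phi ->
  X a -> X b -> pA * a = pA * b -> pB * Phi a = pB * Phi b.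
Proof.
move=> hA hB iX iY hf Xa Xb pab.
have [f1 f2 f3 f4] := hf; have [[_ _ mX uX _] _] := iX; have [[_ _ mY _ _] _] := iY.
have [Psi hg PhiPsi] := order_iso_inv hf; have [g1 g2 g3 g4] := hg.
have cA : cproj pA by case: hA. have cB : cproj pB by case: hB.
have up c d : X c -> X d -> pA * c = pA * d -> ople c d -> pB * Phi c = pB * Phi d.
  move=> Xc Xd pcd cd; have lcd : ople (Phi c) (Phi d) by apply/f4.
  (* y lies between [Phi c] and [Phi d], equal to the first on 1 - pB and to the second on pB. Its
     preimage z agrees with c on 1 - pA by [noncommutative_part_transfer] for the inverse map, and
     on pA by squeezing between c and d. So z = c and y = [Phi c]. *)
  pose y := pB * Phi d + (1 - pB) * Phi c.
  have Yy : Y y by apply: mY => //; apply: f1.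
  have [py qy] := mix_proj (Phi d) (Phi c) cB; rewrite -/y in py qy.
  have cy : ople (Phi c) y.
    rewrite /ople (_ : y - Phi c = pB * (Phi d - Phi c)); first exact: cproj_pos.
    by rewrite /y; ncr.
  have yd : ople y (Phi d).
    rewrite /ople (_ : Phi d - y = (1 - pB) * (Phi d - Phi c)); first exact: cproj_pos (cprojC cB) _.
    by rewrite /y; ncr.
  pose z := Psi y; have Xz : X z by apply: g1.
  have zy : Phi z = y by apply: PhiPsi.
  have cz : ople c z by apply/f4; rewrite ?zy.
  have zd : ople z d by apply/f4; rewrite ?zy.
  have qz : (1 - pA) * c = (1 - pA) * z.
    have PsiPhi x : X x -> Psi (Phi x) = x.
      by move=> Xx; apply: f2; rewrite ?PhiPsi //; [apply: g1|]; apply: f1.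
    rewrite -(PsiPhi c Xc).
    exact: (noncommutative_part_transfer AWB AWA hB hA iY iX hg (f1 _ Xc) Yy (esym qy)).
  have pz : pA * c = pA * z.
    by apply: ople_anti; [exact: ople_proj | rewrite pcd; exact: ople_proj].
  by rewrite -py -zy -(proj_eq pz qz).
have [c [Xc ac bc]] := uX _ _ Xa Xb.
pose d := pA * a + (1 - pA) * c; have Xd : X d by apply: mX.
have [pd _] := mix_proj a c cA; rewrite -/d in pd.
have ad : ople a d.
  by rewrite /ople (_ : d - a = (1 - pA) * (c - a)); [exact: cproj_pos (cprojC cA) _|rewrite /d; ncr].
have bd : ople b d.
  by rewrite /ople /d pab (_ : _ - b = (1 - pA) * (c - b)); [exact: cproj_pos (cprojC cA) _|ncr].
by rewrite (up a d) // (up b d) // -pab.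
Qed.

(** The equivalence makes [q * Phi a] a well-defined and injective function of [p * a]. For the
    order, an inequality on the summand is lifted to the whole interval by central mixing. *)
Lemma order_iso_proj A B (p : A) (q : B) (X : set A) (Y : set B) Phi :
  cproj p -> cproj q -> central_mixing X -> central_mixing Y -> order_iso X Y Phi ->
  (forall a b, X a -> X b -> p * a = p * b <-> q * Phi a = q * Phi b) ->
  exists2 F, order_iso (lmulset p X) (lmulset q Y) F &
    forall a, X a -> F (p * a) = q * Phi a.
Proof.
move=> cp cq mX mY [f1 f2 f3 f4] E.
have [G hG] : {G : A -> A & forall x, lmulset p X x -> X (G x) /\ p * G x = x}.
  apply: (@choice _ _ (fun x a => lmulset p X x -> X a /\ p * a = x)) => x; have [[a Xa ax]|nx] := pselect (lmulset p X x); first by exists a.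
  by exists 0.
pose F x := q * Phi (G x).
have FE a : X a -> F (p * a) = q * Phi a.
  by move=> Xa; have [|XG pG] := hG (p * a); [exists a | apply/E].
exists F => //; split.
- by move=> _ [a Xa <-]; rewrite FE //; exists (Phi a) => //; exact: f1.
- by move=> _ _ [a Xa <-] [b Xb <-]; rewrite !FE // => /E ->.
- by move=> _ [_ /f3[a Xa <-] <-]; exists (p * a); [exists a | exact: FE].
move=> _ _ [a Xa <-] [b Xb <-]; rewrite !FE //; split=> h.
(* b' equals b on p and a on 1 - p, so pa <= pb becomes a <= b', to which Phi applies. The converse
   direction does the same in Y. *)
- have [pb _] := mix_proj b a cp; set b' := p * b + (1 - p) * a in pb.
  have Xb' : X b' by apply: mX.
  have ab' : ople a b'.
    by rewrite /ople (_ : b' - a = p * b - p * a) //; rewrite /b'; ncr.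
  by move/E: pb => <- //; apply: ople_proj => //; apply/f4.
- have Ya := f1 _ Xa; have Yb := f1 _ Xb.
  have [pb _] := mix_proj (Phi b) (Phi a) cq; set y := q * Phi b + (1 - q) * Phi a in pb.
  have /f3[c Xc cy] : Y y by apply: mY.
  have ac : ople a c.
    by apply/f4; rewrite // cy /ople (_ : y - Phi a = q * Phi b - q * Phi a) //; rewrite /y; ncr.
  by move: pb; rewrite -cy => /E <- //; apply: ople_proj.
Qed.

End Transfer.

Theorem theorem3p4 (R : realType) (A B : cstarAlg R)
    (AW_A : AWstar A) (AW_B : AWstar B)
    (pA : A) (pB : B) (HpA : is_pA1 pA) (HpB : is_pA1 pB)
    (I : opint A) (J : opint B) (HI : opint_valid I) (HJ : opint_valid J)
    (Phi : A -> B) (HPhi : order_iso (opint_set I) (opint_set J) Phi) :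
  exists Phi1 Phim1 : A -> B,
    [/\ order_iso (lmulset pA (opint_set I)) (lmulset pB (opint_set J)) Phi1,
        order_iso (lmulset (1 - pA) (opint_set I))
                  (lmulset (1 - pB) (opint_set J)) Phim1,
        (forall a, opint_set I a ->
           Phi a = Phi1 (pA * a) + Phim1 ((1 - pA) * a)) &
        (forall Psi1 Psim1 : A -> B,
           order_iso (lmulset pA (opint_set I)) (lmulset pB (opint_set J)) Psi1 ->
           order_iso (lmulset (1 - pA) (opint_set I))
                     (lmulset (1 - pB) (opint_set J)) Psim1 ->
           (forall a, opint_set I a ->
              Phi a = Psi1 (pA * a) + Psim1 ((1 - pA) * a)) ->
           (forall x, lmulset pA (opint_set I) x -> Psi1 x = Phi1 x) /\
           (forall x, lmulset (1 - pA) (opint_set I) x -> Psim1 x = Phim1 x))].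
Proof.
have iI := opint_interval_like HI; have iJ := opint_interval_like HJ.
have [[_ _ mI _ _] _] := iI; have [[_ _ mJ _ _] _] := iJ.
have cA : cproj pA by case: HpA. have cB : cproj pB by case: HpB.
have [Psi hg PhiPsi] := order_iso_inv HPhi.
have [f1 f2 _ _] := HPhi; have [g1 _ _ _] := hg.
have PsiPhi x : opint_set I x -> Psi (Phi x) = x.
  by move=> Ix; apply: f2; rewrite ?PhiPsi //; [apply: g1|]; apply: f1.
have [|Phi1 hi1 E1] := order_iso_proj cA cB mI mJ HPhi.
  move=> a b Ia Ib; split; first exact: (commutative_part_transfer AW_A AW_B HpA HpB iI iJ HPhi).
  move=> h; rewrite -(PsiPhi a Ia) -(PsiPhi b Ib).
  exact: (commutative_part_transfer AW_B AW_A HpB HpA iJ iI hg (f1 _ Ia) (f1 _ Ib)).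
have [|Phim1 him1 Em1] := order_iso_proj (cprojC cA) (cprojC cB) mI mJ HPhi.
  move=> a b Ia Ib; split; first exact: (noncommutative_part_transfer AW_A AW_B HpA HpB iI iJ HPhi).
  move=> h; rewrite -(PsiPhi a Ia) -(PsiPhi b Ib).
  exact: (noncommutative_part_transfer AW_B AW_A HpB HpA iJ iI hg (f1 _ Ia) (f1 _ Ib)).
exists Phi1, Phim1; split=> // [a Ia|Psi1 Psim1 [p1 _ _ _] [pm1 _ _ _] E].
  by rewrite E1 // Em1 // -mulrDl addrC subrK mul1r.
(* The values of [Psi1] and [Psim1] lie in the complementary summands pB and 1 - pB, so multiplying
   by these projections recovers each term of the sum. *)
have parts a : opint_set I a -> pB * Phi a = Psi1 (pA * a) /\
    (1 - pB) * Phi a = Psim1 ((1 - pA) * a).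
  move=> Ia.
  have [|c _ Ec] := p1 (pA * a); first by exists a.
  have [|d _ Ed] := pm1 ((1 - pA) * a); first by exists a.
  by rewrite (E a Ia) -Ec -Ed; exact: mix_proj.
split=> _ [a Ia <-]; have [e1 e2] := parts a Ia; first by rewrite E1.
by rewrite Em1.
Qed.
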